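(* Suppose Assumptions 1, 2 and 3 hold. Let $\eta>0$ be a constant independent of $N$, and for each $N$ let $\epsilon^{\mathrm{fe}}_N\ge 0$ and $\epsilon^{\mathrm{rd}}_N\ge 0$ satisfy $\epsilon^{\mathrm{fe}}_N\le K_1/N$ and $\epsilon^{\mathrm{rd}}_N\le K_1/N$ for some constant $K_1$ independent of $N$, where $(\eta,\epsilon^{\mathrm{fe}}_N)$ is a feasibility-ensuring pair for every $N$. Let $\pi$ be the two-set policy with parameters $(\eta,\epsilon^{\mathrm{fe}}_N,\epsilon^{\mathrm{rd}}_N)$. Then there exist constants $C>0$ and $K>0$, independent of $N$, such that for every $N$ (with $\alpha N$ an integer) and every initial state vector $\mathbf S_0$, $$R^{\mathrm{rel}}-R(\pi,\mathbf S_0)\le K e^{-CN}.$$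
   Context: Restless bandit (RB) setup. A single-armed MDP $(\mathbb S,\mathbb A,P,r)$ has finite state space $\mathbb S$, action set $\mathbb A=\{0,1\}$, transition kernel $P:\mathbb S\times\mathbb A\times\mathbb S\to[0,1]$ and reward $r:\mathbb S\times\mathbb A\to\mathbb R$; $\alpha\in(0,1)$ is the budget fraction. The $N$-armed problem ($\alpha N$ an integer) has $N$ arms indexed by $[N]$; given their states and actions, arms transition independently according to $P$. At each time $t$ a policy chooses actions $A_t(i)\in\{0,1\}$ with $\sum_{i\in[N]}A_t(i)=\alpha N$. $S_t(i)$ is the state of arm $i$ at time $t$ and $\mathbf S_t$ the state vector. For $D\subseteq[N]$, $m(D)=|D|/N$ and $X_t(D)=(X_t(D,s))_{s\in\mathbb S}$ (a row vector) with $X_t(D,s)=\frac1N\#\{i\in D:S_t(i)=s\}$; the map $D\mapsto X_t(D)$ is the system state, a generic system state being written $x$. The long-run average reward of a policy $\pi$ from $\mathbf S_0$ is $R(\pi,\mathbf S_0)=\lim_{T\to\infty}\frac1T\sum_{t=0}^{T-1}\frac1N\sum_{i}\mathbb E[r(S_t(i),A_t(i))]$. LP relaxation: maximize $\sum_{s,a}r(s,a)y(s,a)$ over $y\ge0$ subject to $\sum_s y(s,1)=\alpha$, $\sum_{s',a}y(s',a)P(s',a,s)=\sum_a y(s,a)$ for all $s$, and $\sum_{s,a}y(s,a)=1$. $R^{\mathrm{rel}}$ is its optimal value and $y^*$ a fixed optimal solution. Define $\bar\pi^*(a|s)=y^*(s,a)/(y^*(s,0)+y^*(s,1))$ if $y^*(s,0)+y^*(s,1)>0$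 and $\bar\pi^*(a|s)=1/2$ otherwise, and $P_{\bar\pi^*}(s,s')=\sum_a\bar\pi^*(a|s)P(s,a,s')$. Assumption 1 (aperiodic unichain): $1$ is a simple eigenvalue of $P_{\bar\pi^*}$ and all other eigenvalues have modulus $<1$. Then $\mu^*(s)=y^*(s,0)+y^*(s,1)$ is its unique stationary distribution (row vector). Assumption 2 (non-degeneracy): there is a unique state $\tilde s$ with $y^*(\tilde s,0)>0$ and $y^*(\tilde s,1)>0$. Under Assumption 2 let $\Phi=P_{\bar\pi^*}-\mathbf 1^\top\mu^*-(c-\alpha\mathbf 1)^\top(P_1(\tilde s)-P_0(\tilde s))$, where $c=(\bar\pi^*(1|s))_{s}$, $P_a(\tilde s)=(P(\tilde s,a,s))_s$ are row vectors and $\mathbf 1$ is the all-ones row vector. Assumption 3 (local stability): all eigenvalues of $\Phi$ have modulus $<1$. Let $S^+=\{s:y^*(s,1)>0,y^*(s,0)=0\}$, $S^-=\{s:y^*(s,1)=0,y^*(s,0)>0\}$, $S^\emptyset=\{s:y^*(s,1)=y^*(s,0)=0\}$. Randomized rounding of a real $c\ge0$: the random integer equal to $\lceil c\rceil$ with probability $c-\lfloor c\rfloor$ and to $\lfloor c\rfloor$ otherwise (so its mean is $c$). Unconstrained Optimal Control (UOC) applied to a set of arms with $z(s)$ arms in state $s$: for each $s$, activate a randomized rounding of $\bar\pi^*(1|s)z(s)$ of the arms in state $s$. Optimal Local Control (OLC) applied to a set of $n$ arms with $z(s)$ arms in state $s$, defined when the OLC condition $\sum_{s\neq\tilde s}\bar\pi^*(1|s)z(s)\le\alpha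 n-|S^\emptyset|-1$ and $\sum_{s\neq\tilde s}\bar\pi^*(0|s)z(s)\le(1-\alpha)n-|S^\emptyset|-1$ holds: let the target budget $B$ be a randomized rounding of $\alpha n$; activate all arms in states of $S^+$, none in states of $S^-$, a randomized rounding of $z(s)/2$ arms in each state $s\in S^\emptyset$, and activate arms in state $\tilde s$ so that exactly $B$ arms of the set are active. Weighted norm: $U=\sum_{k\ge0}\Phi^k(\Phi^\top)^k$ and $\|v\|_U=\sqrt{vUv^\top}$. Slack: for a pair $(\eta,\epsilon^{\mathrm{fe}})$, $\delta(x,D)=\eta\,m(D)-\|x(D)-m(D)\mu^*\|_U-\epsilon^{\mathrm{fe}}$. The pair is feasibility-ensuring if for every system state $x$ and $D\subseteq[N]$ with $\delta(x,D)\ge0$ the OLC condition holds with $z(s)=Nx(D,s)$, $n=|D|$. For $\epsilon^{\mathrm{rd}}\ge0$, $D$ is $\epsilon^{\mathrm{rd}}$-maximal feasible for $x$ if (i) $\delta(x,D)\ge0$ or $D=\emptyset$, and (ii) every $D'\supseteq D$ with $\delta(x,D')\ge\epsilon^{\mathrm{rd}}$ satisfies $m(D')\le m(D)+\epsilon^{\mathrm{rd}}$. Two-set policy with parameters $(\eta,\epsilon^{\mathrm{fe}},\epsilon^{\mathrm{rd}})$, $\beta=\min(\alpha,1-\alpha)$: set $D^{\mathrm{OL}}_{-1}=D^{\pi}_{-1}=\emptyset$. At each $t\ge0$: (1) if $\delta(X_t,[N])\ge0$ let $D^{\mathrm{OL}}_t=[N]$; else if $\delta(X_t,D^{\mathrm{OL}}_{t-1})\ge0$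 let $D^{\mathrm{OL}}_t$ be an $\epsilon^{\mathrm{rd}}$-maximal feasible set for $X_t$ containing $D^{\mathrm{OL}}_{t-1}$; else let $D^{\mathrm{OL}}_t$ be any $\epsilon^{\mathrm{rd}}$-maximal feasible set for $X_t$. (2) Choose $D^\pi_t$ with $D^\pi_{t-1}\setminus D^{\mathrm{OL}}_t\subseteq D^\pi_t\subseteq[N]\setminus D^{\mathrm{OL}}_t$ and $|D^\pi_t|=\lfloor\beta(N-|D^{\mathrm{OL}}_t|)\rfloor$. (3) Arms in $D^{\mathrm{OL}}_t$ act by OLC applied to $D^{\mathrm{OL}}_t$, arms in $D^\pi_t$ by UOC applied to $D^\pi_t$, and the remaining arms receive actions making $\sum_iA_t(i)=\alpha N$ (always possible). All choices in (1)–(3) are made by a fixed rule depending only on $(X_t,D^{\mathrm{OL}}_{t-1},D^\pi_{t-1})$ and independent randomization, so that $(X_t,D^{\mathrm{OL}}_t,D^\pi_t)$ is a finite-state Markov chain and $R(\pi,\mathbf S_0)$ is well defined. *)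

(* Defs.v *)
From HB Require Import structures.
From mathcomp Require Import all_boot all_order all_algebra.
From mathcomp Require Import all_classical all_reals all_analysis.
From mathcomp Require Import complex.

Set Implicit Arguments.
Unset Strict Implicit.
Unset Printing Implicit Defensive.

Import Order.TTheory GRing.Theory Num.Theory numFieldNormedType.Exports.
Local Open Scope ring_scope.

(* States of the single-armed MDP are 'I_n (a generic finite state space);
   actions are bool (false = 0 = passive, true = 1 = active);
   arms of the N-armed problem are 'I_N.                                   *)

Section RB.
Context {R : realType} {n : nat}.
Variables (P : 'I_n -> bool -> 'I_n -> R) (r : 'I_n -> bool -> R) (alpha : R).

Definition kernel_ok : Prop :=
  (forall s a s', 0 <= P s a s') /\ (forall s a, \sum_(s' < n) P s a s' = 1).

Definition lp_feasible (y : 'I_n -> bool -> R) : Prop :=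
  [/\ (forall s a, 0 <= y s a),
      \sum_(s < n) y s true = alpha,
      (forall s, \sum_(s' < n) \sum_(a : bool) y s' a * P s' a s = \sum_(a : bool) y s a)
    & \sum_(s < n) \sum_(a : bool) y s a = 1].

Definition lp_obj (y : 'I_n -> bool -> R) : R :=
  \sum_(s < n) \sum_(a : bool) r s a * y s a.

(* y is an optimal solution of the LP relaxation; then R^rel = lp_obj y *)
Definition lp_optimal (y : 'I_n -> bool -> R) : Prop :=
  lp_feasible y /\ (forall y', lp_feasible y' -> lp_obj y' <= lp_obj y).

Variable (y : 'I_n -> bool -> R).

Definition pibar (a : bool) (s : 'I_n) : R :=
  if 0 < y s false + y s true then y s a / (y s false + y s true) else 2^-1.

Definition Ppi : 'M[R]_n := \matrix_(s, s') \sum_(a : bool) pibar a s * P s a s'.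

Definition mustar : 'rV[R]_n := \row_s (y s false + y s true).

Definition cmx (A : 'M[R]_n) : 'M[R[i]]_n := map_mx (fun x => (x%:C)%C) A.

Definition assumption1 : Prop :=
  [/\ eigenvalue (cmx Ppi) 1,
      mup 1 (char_poly (cmx Ppi)) = 1%N
    & forall lam : R[i], eigenvalue (cmx Ppi) lam -> lam != 1 -> `|lam| < 1].

Definition assumption2 (st : 'I_n) : Prop :=
  forall s, (0 < y s false /\ 0 < y s true) <-> s = st.

Variable (st : 'I_n).

Definition Phi : 'M[R]_n :=
  Ppi - (\matrix_(s, s') mustar 0 s')
      - (\matrix_(s, s') ((pibar true s - alpha) * (P st true s' - P st false s'))).

Definition assumption3 : Prop :=
  forall lam : R[i], eigenvalue (cmx Phi) lam -> `|lam| < 1.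

Definition Splus (s : 'I_n) : bool := (0 < y s true) && (y s false == 0).
Definition Sminus (s : 'I_n) : bool := (y s true == 0) && (0 < y s false).
Definition Sempty (s : 'I_n) : bool := (y s true == 0) && (y s false == 0).

Definition Umat : 'M[R]_n :=
  \matrix_(i, j) limn (fun K : nat => \sum_(k < K) (Phi ^+ k *m (Phi^T) ^+ k) i j).

Definition Unorm (v : 'rV[R]_n) : R := Num.sqrt ((v *m Umat *m v^T) 0 0).

Section Narms.
Variable N : nat.

Definition svec := {ffun 'I_N -> 'I_n}.
Definition avec := {ffun 'I_N -> bool}.

Definition cnt (sv : svec) (D : {set 'I_N}) (s : 'I_n) : nat :=
  #|[set i in D | sv i == s]|.

Definition xD (sv : svec) (D : {set 'I_N}) : 'rV[R]_n :=
  \row_s ((cnt sv D s)%:R / N%:R).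

Definition mD (D : {set 'I_N}) : R := #|D|%:R / N%:R.

Definition slack (eta eps : R) (sv : svec) (D : {set 'I_N}) : R :=
  eta * mD D - Unorm (xD sv D - mD D *: mustar) - eps.

Definition nSempty : nat := #|[pred s | Sempty s]|.

Definition olc_cond (sv : svec) (D : {set 'I_N}) : Prop :=
  \sum_(s < n | s != st) pibar true s * (cnt sv D s)%:R
     <= alpha * #|D|%:R - nSempty%:R - 1
  /\ \sum_(s < n | s != st) pibar false s * (cnt sv D s)%:R
     <= (1 - alpha) * #|D|%:R - nSempty%:R - 1.

Definition feas_ensuring (eta eps : R) : Prop :=
  forall (sv : svec) (D : {set 'I_N}), 0 <= slack eta eps sv D -> olc_cond sv D.

Definition maxfeas (eta eps erd : R) (sv : svec) (D : {set 'I_N}) : Prop :=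
  (0 <= slack eta eps sv D \/ D = finset.set0) /\
  (forall D' : {set 'I_N}, D \subset D' -> erd <= slack eta eps sv D' ->
      mD D' <= mD D + erd).

(* randomized rounding law: probability that the rounding of c equals k *)
Definition rr (c : R) (k : int) : R :=
  (if k == Num.ceil c then c - (Num.floor c)%:~R else 0) +
  (if k == Num.floor c then 1 - (c - (Num.floor c)%:~R) else 0).

(* chain state (S_t, D^OL_{t-1}, D^pi_{t-1}) and decision (D^OL_t, D^pi_t, A_t) *)
Definition cstate := (svec * {set 'I_N} * {set 'I_N})%type.
Definition dec := ({set 'I_N} * {set 'I_N} * avec)%type.

(* a (randomized) decision rule of the policy: distribution over decisions *)
Definition rule := cstate -> dec -> R.

Definition beta : R := Num.min alpha (1 - alpha).

Definition valid_dec (eta eps erd : R) (sg : cstate) (d : dec) : Prop :=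
  let: (sv, DOLp, Dpip) := sg in
  let: (DOL, Dpi, a) := d in
  [/\ (if 0 <= slack eta eps sv [set: 'I_N] then DOL = [set: 'I_N]
       else if 0 <= slack eta eps sv DOLp
            then DOLp \subset DOL /\ maxfeas eta eps erd sv DOL
            else maxfeas eta eps erd sv DOL),
      [/\ Dpip :\: DOL \subset Dpi, Dpi \subset ~: DOL &
          (#|Dpi|%:R <= beta * (N - #|DOL|)%:R < #|Dpi|%:R + 1)],
      (forall i, i \in DOL -> Splus (sv i) -> a i),
      (forall i, i \in DOL -> Sminus (sv i) -> ~~ a i)
    & #|[set i | a i]|%:R = alpha * N%:R].

Definition cnt_act (sv : svec) (a : avec) (D : {set 'I_N}) (s : 'I_n) : nat :=
  #|[set i in D | (sv i == s) && a i]|.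

(* the decision distribution q at chain state sg is a valid two-set-policy
   decision: a probability distribution supported on valid decisions and,
   conditionally on (D^OL_t, D^pi_t), the rounded quantities (target budget B
   of OLC, activated counts in S^empty states under OLC, activated counts per
   state under UOC) are independent randomized roundings of the prescribed
   values. *)
Definition valid_at (eta eps erd : R) (sg : cstate) (q : dec -> R) : Prop :=
  let: (sv, _, _) := sg in
  [/\ (forall d, 0 <= q d),
      \sum_(d : dec) q d = 1,
      (forall d, 0 < q d -> valid_dec eta eps erd sg d)
    & forall (DOL Dpi : {set 'I_N}) (kB : int) (k0 kp : 'I_n -> int),
        \sum_(a : avec | [&& (#|[set i in DOL | a i]|%:Z == kB),
                             [forall s, Sempty s ==> ((cnt_act sv a DOL s)%:Z == k0 s)]
                           & [forall s, (cnt_act sv a Dpi s)%:Z == kp s]])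
            q (DOL, Dpi, a)
        = (\sum_(a : avec) q (DOL, Dpi, a))
          * rr (alpha * #|DOL|%:R) kB
          * (\prod_(s < n | Sempty s) rr ((cnt sv DOL s)%:R / 2) (k0 s))
          * (\prod_(s < n) rr (pibar true s * (cnt sv Dpi s)%:R) (kp s))].

Definition step (q : rule) (mu : cstate -> R) : cstate -> R :=
  fun sg' => let: (sv', DOL', Dpi') := sg' in
   \sum_(sg : cstate) mu sg *
     \sum_(a : avec) q sg (DOL', Dpi', a) *
        \prod_(i < N) P (sg.1.1 i) (a i) (sv' i).

Definition dist (q : rule) (S0 : svec) (t : nat) : cstate -> R :=
  iter t (step q) (fun sg => if sg == (S0, finset.set0, finset.set0) then 1 else 0).

Definition exp_rew (q : rule) (S0 : svec) (t : nat) : R :=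
  \sum_(sg : cstate) dist q S0 t sg *
    \sum_(d : dec) q sg d * (N%:R^-1 * \sum_(i < N) r (sg.1.1 i) (d.2 i)).

Definition avg_reward (q : rule) (S0 : svec) : R :=
  limn (fun T : nat => T%:R^-1 * \sum_(t < T) exp_rew q S0 t).

Definition two_set_policy (eta eps erd : R) (q : rule) : Prop :=
  forall (S0 : svec) (t : nat) (sg : cstate),
    0 < dist q S0 t sg -> valid_at eta eps erd sg (q sg).

End Narms.
End RB.

(* Main.v *)
Require Import Defs.
From HB Require Import structures.
From mathcomp Require Import all_boot all_order all_algebra.
From mathcomp Require Import all_classical all_reals all_analysis.
From mathcomp Require Import complex ring lra.

(* Let D = D^OL_t. While all arms follow OLC, the mean of X_t([N]) - mustar evolves exactly
   by Phi and the mean reward is affine in it, so the long-run gap is at most a constant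
   times the long-run probability that the slack of [N] is negative.  This probability is
   exponentially small: call a step quiet if the empirical transitions of D^OL_t and D^pi_t
   are within eps of their means, which fails with probability O(exp(- eps^2 N / 8)).  On a
   quiet trajectory a set D of non-negligible mass keeps nonnegative slack, since the norm
   contracts under Phi, so D can only grow; and as long as D is not almost everything, the
   arms of D^pi mix to mustar and maximality makes D gain a fixed mass within a fixed number
   of steps.  Hence a number T of quiet steps independent of N makes the slack of [N]
   nonnegative from any state, and the probability of the contrary is at most T times that
   of a loud step. *)

Set Implicit Arguments.
Unset Strict Implicit.
Unset Printing Implicit Defensive.
Import Order.TTheory GRing.Theory Num.Theory numFieldNormedType.Exports.
Local Open Scope ring_scope.

(** Monotone growth of D^OL is available only from a threshold mass c on: below it the one-step
    error can exceed the slack, and D^OL may be dropped and replaced altogether. But sets of mass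
    below c exchange little mass at a time, so D^pi, whose arms stay unless absorbed, hardly changes
    and still has time to mix. Both regimes thus obey one estimate over a window of L steps, in
    terms of the total change of D^OL. Two levels of precision coexist. Along a quiet trajectory a
    constant error e is tolerable, so it is enough that every rounding is within 1 of its target.
    For the reward, a bias of order 1/N would already destroy the exponential rate; there the
    unbiasedness of the roundings and the integrality of alpha N give identities without remainder
    whenever the slack of [N] is nonnegative. The average reward is handled through sums over time
    rather than a stationary law, which avoids any statement about recurrent classes. *)

(** * Decay of matrix powers *)

(* If the rows of B form a basis whose first rank K rows span K, then the first
   rank K rows of B *m ('X - A) are multiples of 'X - a. *)
Lemma eigen_mult_le (F : fieldType) n (A K : 'M[F]_n) (a : F) :
  K *m A = a *: K -> ('X - a%:P) ^+ (\rank K) %| char_poly A.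
Proof.
move=> KA; set B := row_ebase K.
have BA (i : 'I_n) : (i < \rank K)%N -> row i B *m A = a *: row i B.
  move=> ir.
  have e : row i B = row i (invmx (col_ebase K) *m K).
    rewrite -{2}(mulmx_ebase K) -mulmxA mulKmx ?col_ebase_unit // row_mul.
    suff -> : row i (pid_mx (\rank K) : 'M[F]_n) = row i 1%:M by rewrite -row_mul mul1mx.
    by apply/rowP=> j; rewrite !mxE ir andbT.
  by rewrite e row_mul -mulmxA KA -scalemxAr.
pose D : 'rV[{poly F}]_n := \row_i (if (i < \rank K)%N then 'X - a%:P else 1).
pose E := map_mx polyC B *m char_poly_mx A.
pose Z : 'M[{poly F}]_n := \matrix_(i, j) (if (i < \rank K)%N then (B i j)%:P else E i j).
have EZ : E = diag_mx D *m Z.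
  apply/matrixP=> i j; rewrite mul_diag_mx !mxE; case: ifP => ir; last first.
    by rewrite mul1r.
  have := BA i ir; move/rowP/(_ j); rewrite !mxE => h.
  rewrite (eq_bigr (fun k => (B i k)%:P * 'X *+ (k == j) - (B i k * A k j)%:P)); last first.
    by move=> k _; rewrite polyCM /char_poly_mx !mxE mulrBr mulrnAr.
  rewrite sumrB (bigD1 j) //= eqxx mulr1n big1 ?addr0; last first.
    by move=> k kj; rewrite (negbTE kj).
  rewrite -(rmorph_sum polyC) /=.
  have -> : \sum_(k < n) B i k * A k j = a * B i j.
    by rewrite -h; apply: eq_bigr => k _; rewrite !mxE.
  by rewrite mulrBl polyCM mulrC.
have := congr1 determinant EZ; rewrite /E !det_mulmx det_map_mx /= det_diag => h.
have hD : \prod_i D 0 i = ('X - a%:P) ^+ \rank K.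
  under eq_bigr do rewrite mxE.
  by rewrite -big_mkcond /= (big_ord_narrow (rank_leq_row K)) prodr_const card_ord.
rewrite -hD; have /dvdpZr <- : \det B != 0 by rewrite -unitfE -unitmxE row_ebase_unit.
by rewrite -mul_polyC h dvdp_mulr.
Qed.

(* Induction on the roots: W A^(k+1) = l W A^k + W (A - l) A^k. *)
Lemma krylov_decay (C : numFieldType) n m (A : 'M[C]_n.+1) (r : C) (s : seq C)
    (W : 'M[C]_(m, n.+1)) :
  (forall l, l \in s -> `|l| < r) -> 0 < r ->
  W *m horner_mx A (\prod_(l <- s) ('X - l%:P)) = 0 ->
  exists2 c : C, 0 <= c & forall k i j, `|(W *m A ^+ k) i j| <= c * r ^+ k.
Proof.
move=> + r0; elim: s W => [|l s IH] W sr.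
  rewrite big_nil rmorph1 mulmx1 => ->; exists 0 => // k i j.
  by rewrite mul0mx mxE normr0 mul0r.
rewrite big_cons rmorphM /= rmorphB /= horner_mx_X horner_mx_C mulmxA => h.
have [|c c0 hc] := IH _ _ h; first by move=> x xs; apply: sr; rewrite inE xs orbT.
have lr : `|l| < r by apply: sr; rewrite inE eqxx.
have rl : 0 < r - `|l| by rewrite subr_gt0.
pose c1 := \sum_i \sum_j `|W i j|; have c10 : 0 <= c1 by do 2!apply: sumr_ge0 => ? _.
(* [c1] covers k = 0; the second term is the least x with c + |l| x <= r x, which is what the
   induction step asks for. *)
pose c2 := c1 + c / (r - `|l|).
have c20 : 0 <= c2 by rewrite addr_ge0 // divr_ge0 // ltW.
exists c2 => // k i j; elim: k => [|k IHk].
  rewrite !expr0 mulmx1 mulr1; apply: (@le_trans _ _ c1); last first.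
    by rewrite lerDl divr_ge0 // ltW.
  rewrite /c1.
  rewrite (bigD1 i) //= (bigD1 j) //= -addrA lerDl addr_ge0 ?sumr_ge0 // => *.
  by rewrite sumr_ge0.
have -> : W *m A ^+ k.+1 = W *m (A - l%:M) *m A ^+ k + l *: (W *m A ^+ k).
  by rewrite exprS -mulmxE mulmxA mulmxBr mulmxBl mul_mx_scalar -scalemxAl addrNK.
rewrite mxE (le_trans (ler_normD _ _)) // [X in _ + `|X|]mxE normrM.
apply: (@le_trans _ _ (c * r ^+ k + `|l| * (c2 * r ^+ k))).
  by apply: lerD; [exact: hc | apply: ler_wpM2l].
rewrite mulrA -mulrDl exprS mulrA.
apply: ler_wpM2r; first by rewrite exprn_ge0 // ltW.
rewrite -lerBrDr [`|l| * _]mulrC -mulrBr /c2 mulrDl -mulrA mulVf ?gt_eqF // mulr1.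
by rewrite lerDr mulr_ge0 // ltW.
Qed.

Lemma bounded_mod_lt1 (R : realType) (s : seq R[i]) :
  (forall l, l \in s -> `|l| < 1) ->
  exists2 r : R, 0 < r < 1 & forall l, l \in s -> `|l| < (r%:C)%C.
Proof.
elim: s => [|l s IH] h; first by exists (1/2) => //; lra.
have [|r r01 hr] := IH; first by move=> x xs; apply: h; rewrite inE xs orbT.
have hl : `|l| < 1 by apply: h; rewrite inE eqxx.
pose x := Num.sqrt (complex.Re l ^+ 2 + complex.Im l ^+ 2).
have lx : `|l| = (x%:C)%C by exact: normc_def.
have x1 : x < 1 by move: hl; rewrite lx -(ltcR x 1).
have x0 : 0 <= x by rewrite sqrtr_ge0.
exists (Num.max r ((x + 1) / 2)).
  rewrite lt_max gt_max; case/andP: r01 => -> -> /=; lra.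
move=> y; rewrite inE => /orP[/eqP ->|ys].
  by rewrite lx ltcR lt_max; apply/orP; right; lra.
by apply: (lt_le_trans (hr _ ys)); rewrite lecR le_max lexx.
Qed.

(** Annihilation is asked of [W] only: a list of roots omitting 1 is admissible when [W] projects
    away from the eigenvalue 1. *)
Lemma krylov_decay_real (R : realType) n (A W : 'M[R]_n.+1) (s : seq R[i]) :
  (forall l, l \in s -> `|l| < 1) ->
  cmx W *m horner_mx (cmx A) (\prod_(l <- s) ('X - l%:P)) = 0 ->
  exists c r : R, [/\ 0 <= c, 0 < r < 1 &
    forall k i j, `|(W *m A ^+ k) i j| <= c * r ^+ k].
Proof.
move=> /bounded_mod_lt1[r r01 hr] hW; have /andP[r0 r1] := r01.
have r0C : 0 < (r%:C)%C :> R[i] by rewrite ltcR.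
have [c c0 hc] := krylov_decay hr r0C hW.
have cE : c = ((complex.Re c)%:C)%C.
  by move: c0; clear; case: c => a b; rewrite lecE /= => /andP[/eqP-> _].
exists (complex.Re c), r; split=> //; first by rewrite -lecR -cE.
move=> k i j; rewrite -lecR rmorphM rmorphXn /= -cE.
have -> : (`|(W *m A ^+ k) i j|%:C)%C = `|(cmx W *m cmx A ^+ k) i j|.
  rewrite /cmx -(rmorphXn (map_mx (real_complex R))) /= -map_mxM [X in _ = `|X|]mxE.
  suff nR (x : R) : `|(x%:C)%C| = (`|x|%:C)%C by exact: (esym (nR _)).
  by rewrite normc_def /= expr0n /= addr0 sqrtr_sqr.
exact: hc.
Qed.

(** With [W] = 1 and all roots of the characteristic polynomial, the annihilation hypothesis is
    Cayley-Hamilton. *)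
Lemma spectral_decay (R : realType) n (A : 'M[R]_n) :
  (forall lam : R[i], eigenvalue (cmx A) lam -> `|lam| < 1) ->
  exists c r : R, [/\ 0 <= c, 0 < r < 1 & forall k i j, `|(A ^+ k) i j| <= c * r ^+ k].
Proof.
case: n A => [|n] A h; first by exists 0, (1/2); split=> //; [lra|move=> k []].
have [s hs] := closed_field_poly_normal (char_poly (cmx A)).
have hs1 : forall l, l \in s -> `|l| < 1.
  move=> l ls; apply: h; rewrite eigenvalue_root_char hs rootZ ?root_prod_XsubC //.
  by rewrite (monicP (char_poly_monic _)) oner_eq0.
have [|c [r [c0 r01 hc]]] := @krylov_decay_real _ _ A 1%:M s hs1.
  rewrite /cmx map_mx1 mul1mx; move: hs.
  by rewrite (monicP (char_poly_monic _)) scale1r => <-; exact: Cayley_Hamilton.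
by exists c, r; split=> // k i j; rewrite -[A ^+ k]mul1mx.
Qed.

(** Algebraic multiplicity one bounds the dimension of the space of fixed row vectors by one,
    through [eigen_mult_le]. *)
Lemma simple_fixed_line (F : fieldType) n (A : 'M[F]_n) (mu v : 'rV[F]_n) :
  mup 1 (char_poly A) = 1%N -> mu *m A = mu -> v *m A = v -> mu != 0 ->
  exists a, v = a *: mu.
Proof.
move=> h1 muA vA mu0.
pose K := kermx (A - 1%:M).
have inK (w : 'rV_n) : w *m A = w -> (w <= K)%MS.
  by move=> wA; apply/sub_kermxP; rewrite mulmxBr wA mulmx1 subrr.
have KA : K *m A = 1 *: K.
  by apply/eqP; rewrite scale1r -subr_eq0 -{2}[K]mulmx1 -mulmxBr mulmx_ker.
have rK : (\rank K <= 1)%N.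
  have := eigen_mult_le KA; rewrite -mup_geq ?h1 //.
  by rewrite monic_neq0 // char_poly_monic.
have Kmu : (K <= mu)%MS.
  rewrite -(mxrank_leqif_sup (inK _ muA)).
  by rewrite eqn_leq mxrankS ?inK //= (leq_trans rK) // lt0n mxrank_eq0.
by have /sub_rVP[a ->] := submx_trans (inK _ vA) Kmu; exists a.
Qed.

Lemma mup_prod_XsubC (F : fieldType) (x : F) (s : seq F) :
  mup x (\prod_(l <- s) ('X - l%:P)) = count_mem x s.
Proof.
elim: s => [|l s IH]; first by rewrite big_nil mupNroot // root1.
rewrite big_cons mupM ?polyXsubC_eq0 ?monic_neq0 ?monic_prod_XsubC // IH /=.
by rewrite -['X - l%:P]expr1 mup_XsubCX; case: eqP.
Qed.

(** Let q be the product over the roots other than 1. By Cayley-Hamilton each row w of (1 - 1 mu)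
    q(A) is fixed by A, hence a multiple of mu; since (1 - 1 mu) 1 = 0 also w 1 = 0, and mu 1 = 1
    forces w = 0. *)
Lemma simple_unit_decay (R : realType) n (A : 'M[R]_n) (mu : 'rV[R]_n) :
  mup 1 (char_poly (cmx A)) = 1%N ->
  (forall lam : R[i], eigenvalue (cmx A) lam -> lam != 1 -> `|lam| < 1) ->
  A *m const_mx 1 = const_mx 1 :> 'cV_n -> mu *m A = mu ->
  (mu *m (const_mx 1 : 'cV_n)) = 1%:M ->
  exists c r : R, [/\ 0 <= c, 0 < r < 1 &
    forall k i j, `|((1%:M - const_mx 1 *m mu) *m A ^+ k) i j| <= c * r ^+ k].
Proof.
case: n A mu => [|n] A mu h1 h A1 muA mu1.
  by exists 0, (1/2); split=> //; [lra|move=> k []].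
have [s hs] := closed_field_poly_normal (char_poly (cmx A)).
move: hs; rewrite (monicP (char_poly_monic _)) scale1r => hs.
have s1 : count_mem 1 s = 1%N by rewrite -mup_prod_XsubC -hs.
have in1 : 1 \in s by rewrite -has_pred1 has_count s1.
have ps := perm_to_rem in1.
have hs1 : forall l, l \in rem 1 s -> `|l| < 1.
  move=> l ls; apply: h.
    by rewrite eigenvalue_root_char hs root_prod_XsubC (mem_rem ls).
  apply: contraTneq ls => ->.
  by have := permP ps (pred1 1); rewrite s1 /= eqxx add1n -has_pred1 has_count => -[<-].
apply: krylov_decay_real hs1 _.
set q := \prod_(l <- _) _.
have qE : char_poly (cmx A) = q * ('X - 1%:P) by rewrite hs (perm_big _ ps) big_cons mulrC.
set o := (const_mx 1 : 'cV[R[i]]_n.+1).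
have cA1 : cmx A *m o = o.
  by rewrite /o -(map_const_mx (real_complex R)) -map_mxM A1 map_const_mx.
have qo : horner_mx (cmx A) q *m o = q.[1] *: o.
  rewrite /q; elim: (rem 1 s) => [|l t IH].
    by rewrite big_nil rmorph1 mul1mx hornerC scale1r.
  rewrite big_cons rmorphM /= -mulmxA IH rmorphB /= horner_mx_X horner_mx_C -scalemxAr.
  by rewrite mulmxBl cA1 mul_scalar_mx hornerM !hornerE -{1}[(o)]scale1r -scalerBl scalerA mulrC.
set W := cmx _; apply/row_matrixP => i; rewrite row0 row_mul.
set u := row i W.
have uo : u *m o = 0.
  rewrite /u -row_mul /W /o -(map_const_mx (real_complex R)) -map_mxM mulmxBl mul1mx.
  by rewrite -mulmxA mu1 mulmx1 subrr map_mx0 row0.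
set w := u *m _.
have wA : w *m cmx A = w.
  apply/eqP; rewrite -subr_eq0 -{2}[w]mulmx1 -mulmxBr /w -mulmxA.
  have := Cayley_Hamilton (cmx A); rewrite qE rmorphM /= rmorphB /= horner_mx_X horner_mx_C.
  by rewrite mulmxE => ->; rewrite mulmx0.
have cmuA : map_mx (real_complex R) mu *m cmx A = map_mx (real_complex R) mu.
  by rewrite -map_mxM muA.
have cmu1 : map_mx (real_complex R) mu *m o = 1%:M.
  by rewrite /o -(map_const_mx (real_complex R)) -map_mxM mu1 map_mx1.
have cmu0 : map_mx (real_complex R) mu != 0.
  apply/eqP=> e; move: cmu1; rewrite e mul0mx => /matrixP/(_ 0 0)/eqP.
  by rewrite !mxE eq_sym oner_eq0.
have [a wE] := simple_fixed_line h1 cmuA wA cmu0.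
have : w *m o = 0 by rewrite /w -mulmxA qo -scalemxAr uo scaler0.
rewrite wE -scalemxAl cmu1 => /matrixP/(_ 0 0); rewrite !mxE mulr1 => ->.
by rewrite scale0r.
Qed.

(** * The Lyapunov norm *)

Definition l1 (R : realType) (n : nat) (v : 'rV[R]_n) : R := \sum_s `|v 0 s|.

Section L1.
Context {R : realType} {n : nat}.
Implicit Types v w : 'rV[R]_n.

Lemma l1_ge0 v : 0 <= l1 v. Proof. exact: sumr_ge0. Qed.

Lemma le_l1 v s : `|v 0 s| <= l1 v.
Proof. by rewrite /l1 (bigD1 s) //= lerDl sumr_ge0. Qed.

Lemma l1D v w : l1 (v + w) <= l1 v + l1 w.
Proof. by rewrite /l1 -big_split ler_sum // => s _; rewrite mxE ler_normD. Qed.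

Lemma l1N v : l1 (- v) = l1 v.
Proof. by apply: eq_bigr => s _; rewrite mxE normrN. Qed.

Lemma l1Z a v : l1 (a *: v) = `|a| * l1 v.
Proof. by rewrite /l1 mulr_sumr; apply: eq_bigr => s _; rewrite mxE normrM. Qed.

Lemma l1_sum (I : finType) (p : pred I) (f : I -> 'rV[R]_n) :
  l1 (\sum_(i | p i) f i) <= \sum_(i | p i) l1 (f i).
Proof.
elim/big_ind2: _ => // [|a b x y h1 h2]; first by rewrite /l1 big1 // => s _; rewrite mxE normr0.
by apply: le_trans (l1D _ _) _; apply: lerD.
Qed.

Lemma l1_le_const v a : (forall s, `|v 0 s| <= a) -> l1 v <= n%:R * a.
Proof.
move=> h; apply: (@le_trans _ _ (\sum_(s < n) a)); first exact: ler_sum.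
by rewrite sumr_const card_ord mulr_natl.
Qed.

Lemma l1_mulmx v (A : 'M[R]_n) c : 0 <= c ->
  (forall i j, `|A i j| <= c) -> l1 (v *m A) <= n%:R * (l1 v * c).
Proof.
move=> c0 h; apply: l1_le_const => s; rewrite mxE.
apply: le_trans (ler_norm_sum _ _ _) _; rewrite /l1 mulr_suml ler_sum // => i _.
by rewrite normrM ler_wpM2l.
Qed.

Lemma l1_stoch v (A : 'M[R]_n) : (forall i j, 0 <= A i j) ->
  (forall i, \sum_j A i j = 1) -> l1 (v *m A) <= l1 v.
Proof.
move=> A0 A1; rewrite /l1.
apply: (@le_trans _ _ (\sum_j \sum_i `|v 0 i| * A i j)).
  apply: ler_sum => j _; rewrite mxE; apply: le_trans (ler_norm_sum _ _ _) _.
  by apply: ler_sum => i _; rewrite normrM [`|A _ _|]ger0_norm.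
by rewrite exchange_big ler_sum //= => i _; rewrite -mulr_sumr A1 mulr1.
Qed.
End L1.

Lemma geometric_dominated_cvg (R : realType) (u : nat -> R) (c r : R) :
  0 < r < 1 -> (forall k, `|u k| <= c * r ^+ k) ->
  cvgn (fun K : nat => \sum_(k < K) u k).
Proof.
move=> /andP[r0 r1] h.
have -> : (fun K : nat => \sum_(k < K) u k) = series u.
  by apply/funext => K; rewrite /series /= big_mkord.
apply: normed_cvg; apply: (@series_le_cvg _ _ (geometric c r)) => //.
- by move=> k; exact: normr_ge0.
- move=> k; exact: le_trans (normr_ge0 _) (h k).
- by apply: is_cvg_geometric_series; rewrite ger0_norm // ltW.
Qed.

Section LyapunovNorm.
Local Open Scope classical_set_scope.
Local Open Scope ring_scope.
Context {R : realType} {n : nat} (A : 'M[R]_n) (c r : R).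
Hypotheses (r01 : 0 < r < 1) (Adec : forall k i j, `|(A ^+ k) i j| <= c * r ^+ k).

(* For A = Phi this is Umat, and nm below is Unorm. *)
Let U : 'M[R]_n :=
  \matrix_(i, j) limn (fun K : nat => \sum_(k < K) (A ^+ k *m (A^T) ^+ k) i j).

Lemma trmxX k : (A^T) ^+ k = (A ^+ k)^T.
Proof.
elim: k => [|k IH]; first by rewrite !expr0 trmx1.
by rewrite exprSr exprS IH -!mulmxE trmx_mul.
Qed.

Lemma lyapunov_sum_cvg i j :
  (fun K : nat => \sum_(k < K) (A ^+ k *m (A^T) ^+ k) i j) @ \oo --> U i j.
Proof.
rewrite mxE; apply: (@geometric_dominated_cvg _ (fun k => (A ^+ k *m (A^T) ^+ k) i j) (n%:R * (c * c)) (r ^+ 2)).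
  by case/andP: r01 => r0 r1; rewrite exprn_gt0 // exprn_ilt1 // ltW.
move=> k; rewrite mxE; apply: le_trans (ler_norm_sum _ _ _) _.
apply: (@le_trans _ _ (\sum_(l < n) (c * c) * r ^+ 2 ^+ k)); last first.
  by rewrite sumr_const card_ord -[leRHS]mulrA [leRHS]mulr_natl.
apply: ler_sum => l _; rewrite normrM trmxX mxE.
rewrite -exprM mulnC exprM expr2 mulrACA; exact: ler_pM.
Qed.

Let form (v w : 'rV[R]_n) : R := (v *m U *m w^T) 0 0.
Let term (v w : 'rV[R]_n) k : R := \sum_j (v *m A ^+ k) 0 j * (w *m A ^+ k) 0 j.

(** The form is the series of inner products of v A^k and w A^k; symmetry, positivity and
    contraction are all read off from it. *)
Lemma form_cvg v w : (fun K : nat => \sum_(k < K) term v w k) @ \oo --> form v w.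
Proof.
have -> : (fun K : nat => \sum_(k < K) term v w k) =
    (fun K : nat => \sum_j (\sum_i v 0 i *
       (\sum_(k < K) (A ^+ k *m (A^T) ^+ k) i j)) * w 0 j).
  apply/funext => K.
  transitivity (\sum_(k < K) (v *m (A ^+ k *m (A^T) ^+ k) *m w^T) 0 0).
    apply: eq_bigr => k _; rewrite trmxX mulmxA -mulmxA -trmx_mul mxE.
    by apply: eq_bigr => j _; rewrite [X in _ = _ * X]mxE.
  under eq_bigr do rewrite mxE.
  rewrite exchange_big /=; apply: eq_bigr => j _.
  rewrite -mulr_suml [w^T _ _]mxE; congr (_ * _).
  rewrite (eq_bigr (fun k : 'I_K => \sum_i v 0 i * (A ^+ k *m (A^T) ^+ k) i j)).
    2: by move=> k _; rewrite mxE.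
  by rewrite exchange_big /=; apply: eq_bigr => i _; rewrite mulr_sumr.
have -> : form v w = \sum_j (\sum_i v 0 i * U i j) * w 0 j.
  by rewrite /form mxE; apply: eq_bigr => j _; rewrite mxE [w^T _ _]mxE.
apply: cvg_big => [|j _]; first exact: add_continuous.
apply: cvgM; last exact: cvg_cst.
apply: cvg_big => [|i _]; first exact: add_continuous.
by apply: cvgM; [exact: cvg_cst | exact: lyapunov_sum_cvg].
Qed.

Lemma formC v w : form v w = form w v.
Proof.
apply: (cvg_unique _ (@form_cvg v w)) => //.
rewrite (_ : (fun K : nat => \sum_(k < K) term v w k) = (fun K : nat => \sum_(k < K) term w v k)).
  exact: form_cvg.
apply/funext => K; apply: eq_bigr => k _; apply: eq_bigr => j _; exact: mulrC.
Qed.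

Lemma term_ge0 v k : 0 <= term v v k.
Proof. by apply: sumr_ge0 => j _; rewrite -expr2 sqr_ge0. Qed.

Let sqsum (v : 'rV[R]_n) := \sum_j v 0 j ^+ 2.

Lemma form_ge v : sqsum v <= form v v.
Proof.
rewrite -(cvg_lim _ (@form_cvg v v)) //; apply: limr_ge; first by apply/cvg_ex; exists (form v v); exact: form_cvg.
exists 1%N => // -[//|K] _; rewrite big_ord_recl.
rewrite (_ : term v v _ = sqsum v); first by rewrite lerDl sumr_ge0 // => k _; exact: term_ge0.
by apply: eq_bigr => j _; rewrite expr0 mulmx1 expr2.
Qed.

Lemma sqsum_ge0 v : 0 <= sqsum v. Proof. by apply: sumr_ge0 => j _; exact: sqr_ge0. Qed.

Lemma form_ge0 v : 0 <= form v v. Proof. exact: le_trans (sqsum_ge0 v) (form_ge v). Qed.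

Lemma formDl u v w : form (u + v) w = form u w + form v w.
Proof. by rewrite /form !mulmxDl mxE. Qed.

Lemma formDr u v w : form u (v + w) = form u v + form u w.
Proof. by rewrite /form linearD /= !mulmxDr mxE. Qed.

Lemma formZl a v w : form (a *: v) w = a * form v w.
Proof. by rewrite /form -!scalemxAl mxE. Qed.

Lemma formZr a v w : form v (a *: w) = a * form v w.
Proof. by rewrite formC formZl formC. Qed.

(* The form is \sum_k |v A^k|^2, so replacing v by v A drops the term k = 0. *)
Lemma form_mulmx v : form (v *m A) (v *m A) = form v v - sqsum v.
Proof.
have h := @form_cvg v v; rewrite -(cvg_shiftS) /= in h.
apply: (cvg_unique _ (@form_cvg (v *m A) (v *m A))) => //.
have -> : (fun K : nat => \sum_(k < K) term (v *m A) (v *m A) k) =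
          (fun K : nat => \sum_(k < K.+1) term v v k - sqsum v).
  apply/funext => K; rewrite big_ord_recl (_ : term v v _ = sqsum v); last first.
    by apply: eq_bigr => j _; rewrite expr0 mulmx1 expr2.
  rewrite addrC addrA addNr add0r; apply: eq_bigr => k _.
  by rewrite /term /= /bump leq0n add1n exprS -mulmxE mulmxA.
by apply: cvgB => //; exact: cvg_cst.
Qed.

Lemma form_cauchy_schwarz v w : form v w ^+ 2 <= form v v * form w w.
Proof.
have h (t : R) : 0 <= form v v + 2 * t * form v w + t ^+ 2 * form w w.
  have := form_ge0 (v + t *: w); rewrite formDl !formDr !formZl !formZr (formC w v).
  by move=> h; apply: le_trans h _; rewrite le_eqVlt; apply/orP; left; apply/eqP; ring.
have [w0|w0] := eqVneq (form w w) 0.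
  have [->|vw] := eqVneq (form v w) 0; first by rewrite expr0n mulr_ge0 // form_ge0.
  (* When [form w w] = 0 the quadratic is affine in t, and this t gives it the value -1. *)
  have := h (- (form v v + 1) / (2 * form v w)); rewrite w0 mulr0 addr0.
  have -> : 2 * (- (form v v + 1) / (2 * form v w)) * form v w = - (form v v + 1) by field.
  by have := form_ge0 v; lra.
have wp : 0 < form w w by rewrite lt_neqAle eq_sym w0 form_ge0.
have := h (- form v w / form w w).
have -> : form v v + 2 * (- form v w / form w w) * form v w + (- form v w / form w w) ^+ 2 * form w w
   = (form v v * form w w - form v w ^+ 2) / form w w by field.
by rewrite pmulr_lge0 ?invr_gt0 // subr_ge0.
Qed.

Let nm (v : 'rV[R]_n) : R := Num.sqrt (form v v).

Lemma nm_triangle u v : nm (u + v) <= nm u + nm v.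
Proof.
rewrite -(ler_pXn2r (n := 2)) ?nnegrE ?addr_ge0 ?sqrtr_ge0 //.
rewrite sqrrD !sqr_sqrtr ?form_ge0 // formDl !formDr (formC v u).
have : form u v <= nm u * nm v.
  rewrite /nm -sqrtrM ?form_ge0 //; apply: le_trans (ler_norm _) _.
  by rewrite -sqrtr_sqr ler_wsqrtr // form_cauchy_schwarz.
by move=> h; rewrite mulr2n; lra.
Qed.

Lemma le_nm (v : 'rV[R]_n) s : `|v 0 s| <= nm v.
Proof.
rewrite -sqrtr_sqr ler_wsqrtr //; apply: le_trans (form_ge v).
by rewrite /sqsum (bigD1 s) //= lerDl sumr_ge0 // => j _; rewrite sqr_ge0.
Qed.

Lemma form_le v : form v v <= (1 + \sum_i \sum_j `|U i j|) * sqsum v.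
Proof.
have hs i : v 0 i ^+ 2 <= sqsum v.
  by rewrite /sqsum (bigD1 i) //= lerDl sumr_ge0 // => j _; rewrite sqr_ge0.
apply: (@le_trans _ _ ((\sum_i \sum_j `|U i j|) * sqsum v)); last first.
  by rewrite ler_wpM2r ?sqsum_ge0 // lerDr.
rewrite /form mxE exchange_big mulr_suml ler_sum // => j _.
rewrite [X in X * _]mxE !mulr_suml ler_sum // => i _.
rewrite [v^T _ _]mxE mulrAC mulrC.
apply: le_trans (ler_norm _) _; rewrite normrM ler_wpM2l //.
rewrite normrM; have := hs i; have := hs j.
rewrite -(real_normK (num_real (v 0 j))) -(real_normK (num_real (v 0 i))).
by have := sqr_ge0 (`|v 0 i| - `|v 0 j|); nra.
Qed.

(** One step removes |v|^2 from the form, and the form is at most a |v|^2, so its value shrinks by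
    the factor 1 - 1/a; a >= 1 keeps this factor nonnegative. *)
Lemma nm_contract : exists rho cu : R, [/\ 0 <= rho < 1, 0 < cu &
  forall v, nm (v *m A) <= rho * nm v /\ nm v <= cu * l1 v].
Proof.
set a := 1 + \sum_i \sum_j `|U i j|.
have a1 : 1 <= a by rewrite lerDl; do 2!apply: sumr_ge0 => ? _.
have a0 : 0 < a by apply: lt_le_trans a1.
have ia : 0 < a^-1 <= 1 by rewrite invr_gt0 a0 invf_le1.
exists (Num.sqrt (1 - a^-1)), (Num.sqrt a); split.
- rewrite sqrtr_ge0 /= -[ltRHS]sqrtr1 ltr_sqrt //; lra.
- by rewrite sqrtr_gt0.
move=> v; split.
  rewrite /nm -sqrtrM; last lra.
  rewrite ler_wsqrtr // form_mulmx mulrBl mul1r lerD2l lerN2 mulrC ler_pdivrMr // mulrC.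
  exact: form_le.
rewrite /nm -[l1 v](ger0_norm (l1_ge0 v)) -sqrtr_sqr -sqrtrM; last exact: ltW.
rewrite ler_wsqrtr //; apply: le_trans (form_le v) _; apply: ler_wpM2l; first exact: ltW.
rewrite /sqsum [leRHS]expr2 {1}/l1 mulr_suml ler_sum // => j _.
by rewrite -real_normK ?num_real // expr2 ler_wpM2l // le_l1.
Qed.
End LyapunovNorm.

(** * Fluid dynamics of the two local policies *)

Section Model.
Context {R : realType} {n : nat}.
Variables (P : 'I_n -> bool -> 'I_n -> R) (alpha : R).
Variables (y : 'I_n -> bool -> R) (st : 'I_n).
Hypotheses (Pok : kernel_ok P) (yfeas : lp_feasible P alpha y).

Let P0 s a s' : 0 <= P s a s'. Proof. by case: Pok. Qed.
Let P1 s a : \sum_s' P s a s' = 1. Proof. by case: Pok. Qed.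
Let y0 s a : 0 <= y s a. Proof. by case: yfeas. Qed.

Lemma pibar_mass s : pibar y false s + pibar y true s = 1.
Proof.
rewrite /pibar; case: ifP => h; last by field.
by rewrite -mulrDl divff // gt_eqF.
Qed.

Lemma pibar_ge0 a s : 0 <= pibar y a s.
Proof. by rewrite /pibar; case: ifP => // h; rewrite divr_ge0 // addr_ge0. Qed.

Lemma pibar_mustar a s : pibar y a s * mustar y 0 s = y s a.
Proof.
rewrite /pibar mxE; case: ifP => [h|/negbT]; first by rewrite divfK // gt_eqF.
rewrite -leNgt => h; have := y0 s true; have := y0 s false.
by case: a => h1 h2; nra.
Qed.

Lemma mustar_ge0 s : 0 <= mustar y 0 s.
Proof. by rewrite mxE addr_ge0. Qed.

Lemma mustar_sum : \sum_s mustar y 0 s = 1.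
Proof.
case: yfeas => _ _ _ <-; apply: eq_bigr => s _.
by rewrite mxE big_bool /= addrC.
Qed.

Lemma Ppi_ge0 s s' : 0 <= Ppi P y s s'.
Proof. by rewrite mxE sumr_ge0 // => a _; rewrite mulr_ge0 ?pibar_ge0. Qed.

Lemma Ppi_sum s : \sum_s' Ppi P y s s' = 1.
Proof.
under eq_bigr do rewrite mxE.
rewrite exchange_big /=; under eq_bigr do rewrite -mulr_sumr P1 mulr1.
by rewrite big_bool /= addrC pibar_mass.
Qed.

Lemma mustar_Ppi : mustar y *m Ppi P y = mustar y.
Proof.
case: yfeas => _ _ bal _; apply/rowP => s'; rewrite !mxE.
transitivity (\sum_(a : bool) y s' a); last by rewrite big_bool /= addrC.
rewrite -bal; apply: eq_bigr => s _; rewrite [Ppi _ _ _ _]mxE mulr_sumr.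
by apply: eq_bigr => a _; rewrite mulrCA mulrA pibar_mustar.
Qed.

Lemma pibar_mustar_sum : \sum_s mustar y 0 s * pibar y true s = alpha.
Proof.
case: yfeas => _ <- _ _; apply: eq_bigr => s _.
by rewrite mulrC pibar_mustar.
Qed.

Lemma Splus_pibar s : Splus y s -> pibar y true s = 1.
Proof.
move=> /andP[h /eqP e]; rewrite /pibar e add0r h divff // gt_eqF //.
Qed.

Lemma Sminus_pibar s : Sminus y s -> pibar y true s = 0.
Proof. by move=> /andP[/eqP e h]; rewrite /pibar e addr0 h mul0r. Qed.

Lemma Sempty_pibar s : Sempty y s -> pibar y true s = 2^-1.
Proof. by move=> /andP[/eqP e /eqP h]; rewrite /pibar e h addr0 ltxx. Qed.

Lemma state_cases s : assumption2 y st ->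
  [\/ s = st, Splus y s, Sminus y s | Sempty y s].
Proof.
move=> h2; have := y0 s true; have := y0 s false; rewrite !le_eqVlt.
move=> /orP[/eqP e|e] /orP[/eqP f|f].
- by apply: Or44; rewrite /Sempty -e -f eqxx.
- by apply: Or42; rewrite /Splus -e f eqxx.
- by apply: Or43; rewrite /Sminus -f e eqxx.
- by apply: Or41; apply/h2.
Qed.

Lemma mulmx_Phi (v : 'rV[R]_n) s' :
  (v *m Phi P alpha y st) 0 s' = (v *m Ppi P y) 0 s' - (\sum_s v 0 s) * mustar y 0 s'
    - (\sum_s v 0 s * (pibar y true s - alpha)) * (P st true s' - P st false s').
Proof.
rewrite /Phi !mulmxBr !mxE !mulr_suml; congr (_ - _ - _).
  by apply: eq_bigr => s _; rewrite !mxE.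
by apply: eq_bigr => s _; rewrite mxE mulrA.
Qed.

(* Mean next occupation vector when mass tau s of the mass x s in state s is
   activated. *)
Definition flow (x tau : 'I_n -> R) : 'rV[R]_n :=
  \row_s' \sum_s ((x s - tau s) * P s false s' + tau s * P s true s').

Lemma flow_UOC (x : 'rV[R]_n) :
  flow (x 0) (fun s => pibar y true s * x 0 s) = x *m Ppi P y.
Proof.
apply/rowP => s'; rewrite !mxE; apply: eq_bigr => s _; rewrite mxE big_bool /=.
have -> : pibar y false s = 1 - pibar y true s by rewrite -(pibar_mass s) addrK.
ring.
Qed.

(** OLC differs from UOC only in [st], where it activates alpha m - \sum_s pibar(1|s) x(s) more
    mass. Each unit of it shifts the flow by P_1(st) - P_0(st), the rank-one correction in Phi; the
    term with mustar vanishes because x - m mustar has zero sum. *)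
Lemma flow_OLC (x : 'rV[R]_n) (tau : 'I_n -> R) (m : R) :
  (forall s, s != st -> tau s = pibar y true s * x 0 s) ->
  \sum_s x 0 s = m -> \sum_s tau s = alpha * m ->
  flow (x 0) tau - m *: mustar y = (x - m *: mustar y) *m Phi P alpha y st.
Proof.
move=> htau hm htm; apply/rowP => s'; rewrite mulmx_Phi mulmxBl -scalemxAl mustar_Ppi.
rewrite -flow_UOC.
have -> : \sum_s (x - m *: mustar y) 0 s = 0.
  under eq_bigr do rewrite !mxE.
  rewrite sumrB hm -mulr_sumr (eq_bigr (fun s => mustar y 0 s)); last by move=> *; rewrite mxE.
  by rewrite mustar_sum mulr1 subrr.
have -> : \sum_s (x - m *: mustar y) 0 s * (pibar y true s - alpha)
   = \sum_s (pibar y true s * x 0 s) - alpha * m.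
  rewrite (eq_bigr (fun s => pibar y true s * x 0 s - alpha * x 0 s
    - m * (mustar y 0 s * pibar y true s) + m * alpha * mustar y 0 s)); last first.
    by move=> s _; rewrite !mxE; ring.
  rewrite big_split sumrB /= sumrB -!mulr_sumr hm mustar_sum pibar_mustar_sum; ring.
rewrite -htm -sumrB (bigD1 st) //= big1 ?addr0; last first.
  by move=> s ss; rewrite htau // subrr.
rewrite !mxE !(bigD1 (P := xpredT) st) //= mul0r subr0.
rewrite [X in _ + X - _ = _](eq_bigr (fun s => (x 0 s - pibar y true s * x 0 s) * P s false s'
   + pibar y true s * x 0 s * P s true s')); last by move=> s ss; rewrite htau.
ring.
Qed.

Lemma l1_flow (x tau tau' : 'I_n -> R) :
  l1 (flow x tau - flow x tau') <= 2 * \sum_s `|tau s - tau' s|.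
Proof.
rewrite /l1; apply: (@le_trans _ _ (\sum_s' \sum_s `|tau s - tau' s| * (P s false s' + P s true s'))).
  apply: ler_sum => s' _; rewrite !mxE -sumrB; apply: le_trans (ler_norm_sum _ _ _) _.
  apply: ler_sum => s _.
  have -> : (x s - tau s) * P s false s' + tau s * P s true s' -
    ((x s - tau' s) * P s false s' + tau' s * P s true s') =
    (tau s - tau' s) * (P s true s' - P s false s') by ring.
  rewrite normrM ler_wpM2l // ler_norml; have := P0 s true s'; have := P0 s false s'; lra.
rewrite exchange_big mulr_sumr ler_sum //= => s _.
by rewrite -mulr_sumr big_split /= !P1 mulrC.
Qed.

(** A vector of zero sum is unchanged by the projection 1 - 1 mustar. *)
Lemma Ppi_mixing : assumption1 P y -> exists c q : R, [/\ 0 <= c, 0 < q < 1 &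
  forall (v : 'rV[R]_n) k, \sum_s v 0 s = 0 -> l1 (v *m Ppi P y ^+ k) <= c * q ^+ k * l1 v].
Proof.
move=> [_ h1 h2].
have [|||c [q [c0 q01 hc]]] := @simple_unit_decay _ _ (Ppi P y) (mustar y) h1 h2.
- apply/colP => s; rewrite !mxE -[RHS](Ppi_sum s); apply: eq_bigr => s' _.
  by rewrite [X in _ * X]mxE mulr1.
- exact: mustar_Ppi.
- apply/matrixP => i j; rewrite !ord1 !mxE -[RHS]mustar_sum; apply: eq_bigr => s _.
  by rewrite [X in _ * X]mxE mulr1.
exists (n%:R * c), q; split=> // [|v k v0]; first by rewrite mulr_ge0.
have -> : v *m Ppi P y ^+ k = v *m ((1%:M - const_mx 1 *m mustar y) *m Ppi P y ^+ k).
  rewrite mulmxA mulmxBr mulmx1 mulmxA.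
  suff -> : v *m (const_mx 1 : 'cV_n) = 0 by rewrite mul0mx subr0.
  apply/matrixP => i j; rewrite !ord1 !mxE -[RHS]v0; apply: eq_bigr => s _.
  by rewrite [X in _ * X]mxE mulr1.
case/andP: q01 => q0 q1.
have h0 : 0 <= c * q ^+ k by rewrite mulr_ge0 // exprn_ge0 // ltW.
by apply: le_trans (l1_mulmx v h0 (hc k)) _; rewrite -!mulrA [l1 v * _]mulrC !mulrA.
Qed.

(** The interface through which the weighted norm is used from here on. *)
Lemma Unorm_facts : assumption3 P alpha y st ->
  (forall v w, Unorm P alpha y st (v + w) <= Unorm P alpha y st v + Unorm P alpha y st w) /\
  (forall (v : 'rV[R]_n) s, `|v 0 s| <= Unorm P alpha y st v) /\
  exists rho cu : R, [/\ 0 <= rho < 1, 0 < cu &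
  forall v, Unorm P alpha y st (v *m Phi P alpha y st) <= rho * Unorm P alpha y st v
    /\ Unorm P alpha y st v <= cu * l1 v].
Proof.
move=> /spectral_decay[c [q [c0 q01 hc]]]; split; [|split].
- exact: nm_triangle q01 hc.
- exact: le_nm q01 hc.
- exact: nm_contract q01 hc.
Qed.
End Model.

(** * Quiet trajectories reach the full set *)

Section Counting.
Context {R : realType} {n N : nat}.
Variables (y : 'I_n -> bool -> R).
Hypotheses (N0 : (0 < N)%N) (mu0 : forall s, 0 <= mustar y 0 s)
  (mu1 : \sum_s mustar y 0 s = 1).
Implicit Types (sv : svec (n:=n) N) (D E : {set 'I_N}).
Local Notation mD := (@mD R N).
Local Notation xD := (@xD R n N).

Let NR : 0 < N%:R :> R. Proof. by rewrite ltr0n. Qed.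

(** The vector whose norm enters [slack]. It is additive over disjoint sets and has zero sum, hence
    is driven to 0 by Ppi. *)
Definition dv sv D : 'rV[R]_n := xD sv D - mD D *: mustar y.

Lemma cnt_sum sv D : (\sum_s cnt sv D s)%N = #|D|.
Proof.
rewrite -sum1_card (partition_big sv xpredT) //=; apply: eq_bigr => s _.
by rewrite /cnt -sum1_card; apply: eq_bigl => i; rewrite inE.
Qed.

Lemma xD_ge0 sv D s : 0 <= xD sv D 0 s.
Proof. by rewrite mxE divr_ge0. Qed.

Lemma xD_sum sv D : \sum_s xD sv D 0 s = mD D.
Proof.
rewrite /mD -(cnt_sum sv) natr_sum mulr_suml.
by apply: eq_bigr => s _; rewrite mxE.
Qed.

Lemma l1_xD sv D : l1 (xD sv D) = mD D.
Proof. by rewrite -(xD_sum sv); apply: eq_bigr => s _; rewrite ger0_norm ?xD_ge0. Qed.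

Lemma mD_ge0 D : 0 <= mD D. Proof. by rewrite divr_ge0. Qed.

Lemma mDT : mD [set: 'I_N] = 1.
Proof. by rewrite /mD cardsT card_ord divff // gt_eqF. Qed.

Lemma mD0 : mD finset.set0 = 0.
Proof. by rewrite /mD cards0 mul0r. Qed.

Lemma mDS D E : D \subset E -> mD D <= mD E.
Proof. by move=> h; rewrite /mD ler_pM2r ?invr_gt0 // ler_nat subset_leq_card. Qed.

Lemma mD_le1 D : mD D <= 1.
Proof. by rewrite -mDT mDS // finset.subsetT. Qed.

Lemma mDU D E : [disjoint D & E] -> mD (D :|: E) = mD D + mD E.
Proof.
by move=> h; rewrite /mD cardsU (disjoint_setI0 h) cards0 subn0 natrD mulrDl.
Qed.

Lemma mDD D E : mD (D :\: E) = mD D - mD (D :&: E).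
Proof.
by rewrite /mD -(cardsID E D) natrD mulrDl [X in X - _]addrC addrK.
Qed.

Lemma xDU sv D E : [disjoint D & E] -> xD sv (D :|: E) = xD sv D + xD sv E.
Proof.
move=> h; apply/rowP => s; rewrite !mxE -mulrDl -natrD; congr (_%:R / _).
rewrite /cnt -[RHS]subn0 -[X in (_ - X)%N](@cards0 ('I_N)).
have <- : [set i in D | sv i == s] :&: [set i in E | sv i == s] = finset.set0.
  apply/setP => i; rewrite !inE; apply/negP => /andP[/andP[iD _] /andP[iE _]].
  by have := disjointFr h iD; rewrite iE.
rewrite -cardsU; apply: eq_card => i; rewrite !inE.
by case: (i \in D); case: (i \in E); case: (_ == _).
Qed.

Lemma dvU sv D E : [disjoint D & E] -> dv sv (D :|: E) = dv sv D + dv sv E.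
Proof. by move=> h; rewrite /dv xDU // mDU // scalerDl opprD addrACA. Qed.

Lemma dv0 sv : dv sv finset.set0 = 0.
Proof.
apply/rowP => s; rewrite !mxE mD0 mul0r oppr0 addr0.
rewrite (_ : cnt _ _ _ = 0%N) ?mul0r //.
by apply/eqP; rewrite cards_eq0; apply/eqP/setP => i; rewrite !inE.
Qed.

Lemma l1_dv sv D : l1 (dv sv D) <= 2 * mD D.
Proof.
apply: le_trans (l1D _ _) _; rewrite l1N l1Z l1_xD ger0_norm ?mD_ge0 //.
have -> : l1 (mustar y) = 1.
  by rewrite -mu1; apply: eq_bigr => s _; rewrite ger0_norm.
lra.
Qed.

Lemma dv_sum sv D : \sum_s dv sv D 0 s = 0.
Proof.
rewrite (eq_bigr (fun s => xD sv D 0 s - mD D * mustar y 0 s)); last first.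
  by move=> s _; rewrite /dv !mxE.
by rewrite sumrB -mulr_sumr xD_sum mu1 mulr1 subrr.
Qed.

Lemma dv_setID sv D E : dv sv D = dv sv (D :&: E) + dv sv (D :\: E).
Proof.
rewrite -dvU ?finset.setID // -setI_eq0; apply/eqP/setP => i; rewrite !inE.
by case: (i \in E); rewrite ?andbF.
Qed.

Lemma l1_dv_diff sv D E :
  l1 (dv sv D - dv sv E) <= 2 * (mD (D :\: E) + mD (E :\: D)).
Proof.
rewrite (dv_setID sv D E) (dv_setID sv E D) finset.setIC.
have -> (a b c : 'rV[R]_n) : a + b - (a + c) = b - c by rewrite opprD addrACA subrr add0r.
apply: le_trans (l1D _ _) _; rewrite l1N mulrDr; apply: lerD; exact: l1_dv.
Qed.
End Counting.

Section Path.
Context {R : realType} {n : nat}.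
Variables (P : 'I_n -> bool -> 'I_n -> R) (alpha : R).
Variables (y : 'I_n -> bool -> R) (st : 'I_n).
Hypotheses (Pok : kernel_ok P) (alpha01 : 0 < alpha < 1) (yfeas : lp_feasible P alpha y).
Local Notation nm := (Unorm P alpha y st).
Local Notation F := (Phi P alpha y st).
Local Notation M := (Ppi P y).
Variables (rho cu c0 q : R).
Hypotheses (nmD : forall v w, nm (v + w) <= nm v + nm w) (rho01 : 0 <= rho < 1)
  (cu0 : 0 < cu) (nmF : forall v, nm (v *m F) <= rho * nm v)
  (nm_l1 : forall v, nm v <= cu * l1 v)
  (mix : forall (v : 'rV[R]_n) k, \sum_s v 0 s = 0 -> l1 (v *m M ^+ k) <= c0 * q ^+ k * l1 v).
(** [c] is the mass from which D^OL only grows, [kappa] the mass of the complement that counts as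
    negligible, [L] a mixing time of Ppi, and [J] a number of gains of [c] that exhausts the total
    mass. *)
Variables (eta e c kappa : R) (L J : nat).
Local Notation beta := (beta alpha).
Hypotheses (eta0 : 0 < eta) (e0 : 0 <= e) (cpos : 0 < c <= 1/4) (kap : 0 <= kappa <= 1/2)
  (Lpos : (0 < L)%N) (Jc : 1 <= J%:R * c) (c0q : 0 <= c0 * q ^+ L).
Hypotheses (C1 : cu * e <= (1 - rho) * (eta * c - e))
  (C2 : cu * (2 * (c0 * q ^+ L) + 3 * e * L%:R + 6 * c * L%:R) + (2 + 2 * eta) * e
        <= eta * beta * kappa)
  (C3 : cu * e + 2 * cu * kappa <= (1 - rho) * (eta / 2 - e)).
Variables (N : nat) (efe erd : R) (sv : nat -> svec (n:=n) N) (A Q : nat -> {set 'I_N}).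
Hypotheses (N0 : (0 < N)%N) (efe0 : 0 <= efe <= e) (erd0 : 0 <= erd <= e).
Let T := (L * J.+1).+1.
Local Notation slack := (slack P alpha y st eta efe).
Local Notation mD := (@mD R N).
Local Notation dv := (dv y).
(* A j and Q j stand for D^OL_j and D^pi_j; the parameter e dominates 1/N, the two
   epsilons of the policy, and every one-step error. *)
Hypotheses
  (Afeas : forall j, (j < T)%N -> 0 <= slack (sv j) (A j) \/ A j = finset.set0)
  (Amax : forall j, (j < T)%N -> forall D : {set 'I_N}, A j \subset D ->
     erd <= slack (sv j) D -> mD D <= mD (A j) + erd)
  (Agrow : forall j, (j.+1 < T)%N -> 0 <= slack (sv j.+1) (A j) -> A j \subset A j.+1)
  (Qdisj : forall j, (j < T)%N -> Q j \subset ~: A j)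
  (Qcard : forall j, (j < T)%N -> mD (Q j) <= beta * (1 - mD (A j)) <= mD (Q j) + e)
  (Qkeep : forall j, (j.+1 < T)%N -> Q j :\: A j.+1 \subset Q j.+1)
  (Astep : forall j, (j < T)%N -> l1 (dv (sv j.+1) (A j) - dv (sv j) (A j) *m F) <= e)
  (Qstep : forall j, (j < T)%N -> l1 (dv (sv j.+1) (Q j) - dv (sv j) (Q j) *m M) <= e).

Let mu0 := mustar_ge0 yfeas.
Let mu1 := mustar_sum yfeas.

Let beta01 : 0 < beta <= 1.
Proof.
by rewrite /Defs.beta lt_min ge_min; case/andP: alpha01 => a0 a1; rewrite a0 subr_gt0 a1 (ltW a1).
Qed.

Lemma slackE v D : slack v D = eta * mD D - nm (dv v D) - efe.
Proof. by []. Qed.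

(** The norm contracts by rho while the allowance eta m(D) stays the same, which frees a fraction 1
    - rho of it to pay for the one-step error. *)
Lemma olc_slack_persists j : (j < T)%N -> c <= mD (A j) ->
  (1 - rho) * (eta * mD (A j) - e) - cu * e <= slack (sv j.+1) (A j).
Proof.
move=> jT cm; have [|A0] := Afeas jT; last first.
  by move: cm; rewrite A0 mD0; move: cpos; lra.
rewrite !slackE => h.
have h1 : nm (dv (sv j.+1) (A j)) <= rho * nm (dv (sv j) (A j)) + cu * e.
  rewrite -[dv (sv j.+1) (A j)](subrK (dv (sv j) (A j) *m F)) addrC.
  apply: le_trans (nmD _ _) _; apply: lerD => //.
  by apply: le_trans (nm_l1 _) _; rewrite ler_pM2l // Astep.
by move: h h1 rho01 efe0; nra.
Qed.

Let g j := 2 * mD (A j.+1 :\: A j) + mD (A j :\: A j.+1).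

(** Arms leave D^pi only by entering D^OL. The arms that enter D^pi are as many as those leaving it
    plus the change of size, and that is beta times the change of the complement of D^OL, up to e;
    hence the weight 2 in [g]. *)
Lemma uoc_set_change j : (j.+1 < T)%N -> mD (Q j.+1 :\: Q j) + mD (Q j :\: Q j.+1) <= g j + e.
Proof.
move=> jT; have jT' := ltnW jT.
have h1 : mD (Q j :\: Q j.+1) <= mD (A j.+1 :\: A j).
  apply: mDS => //; apply/fintype.subsetP => i; rewrite !inE => /andP[iQ' iQ].
  have := fintype.subsetP (Qdisj jT') _ iQ; rewrite inE => -> /=.
  by apply: contraNT iQ' => iA; apply: (fintype.subsetP (Qkeep jT)); rewrite inE iA.
have := Qcard jT; have := Qcard jT'.
have := mDD (R:=R) (Q j.+1) (Q j); have := mDD (R:=R) (Q j) (Q j.+1).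
have := mDD (R:=R) (A j.+1) (A j); have := mDD (R:=R) (A j) (A j.+1).
rewrite (finset.setIC (Q j)) (finset.setIC (A j)) => e1 e2 e3 e4 /andP[q1 q2] /andP[q3 q4].
have := mD_ge0 (R:=R) (A j.+1 :\: A j); have := mD_ge0 (R:=R) (A j :\: A j.+1).
have : beta * (1 - mD (A j.+1)) - beta * (1 - mD (A j)) <= mD (A j :\: A j.+1).
  have -> : beta * (1 - mD (A j.+1)) - beta * (1 - mD (A j)) =
     beta * (mD (A j :\: A j.+1) - mD (A j.+1 :\: A j)) by rewrite e1 e2; ring.
  have := mD_ge0 (R:=R) (A j.+1 :\: A j); have := mD_ge0 (R:=R) (A j :\: A j.+1).
  by move: beta01; nra.
by rewrite /g; lra.
Qed.

(** Each step adds e from the transition and 2 (g + e) from the change of set; earlier errors do not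
    grow, since a stochastic matrix does not increase the l1 norm. *)
Lemma uoc_set_mixing j k : (j + k < T)%N ->
  l1 (dv (sv (j + k)) (Q (j + k)) - dv (sv j) (Q j) *m M ^+ k)
    <= \sum_(i < k) (3 * e + 2 * g (j + i)).
Proof.
elim: k => [|k IH] jT.
  by rewrite addn0 expr0 mulmx1 subrr big_ord0 /l1 big1 // => s _; rewrite mxE normr0.
move: jT; rewrite addnS => jT; have jT' := ltnW jT.
rewrite big_ord_recr /= exprSr -mulmxE mulmxA.
set V := dv (sv j) (Q j) *m _; set a := dv (sv (j + k).+1) (Q (j + k).+1).
set b := dv (sv (j + k).+1) (Q (j + k)); set d := dv (sv (j + k)) (Q (j + k)).
have -> : a - V *m M = (d - V) *m M + ((b - d *m M) + (a - b)).
  by rewrite mulmxBl; apply/rowP => s; rewrite !mxE; ring.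
apply: le_trans (l1D _ _) _; apply: lerD.
  apply: le_trans (IH jT'); apply: l1_stoch; [exact: (Ppi_ge0 Pok yfeas)|exact: (Ppi_sum y Pok)].
apply: le_trans (l1D _ _) _.
have := Qstep jT'; rewrite -/b -/d => h1.
have := l1_dv_diff mu0 mu1 (sv (j + k).+1) (Q (j + k).+1) (Q (j + k)).
by have := uoc_set_change jT; rewrite -/a -/b; lra.
Qed.

(* If D^OL and D^pi change little over L steps, the arms of D^pi mix to mustar, hence
   D^OL together with D^pi is feasible; maximality then forces D^pi, and with it the
   complement of D^OL, to be small. *)
Lemma mixing_window j : (j + L < T)%N -> \sum_(i < L) g (j + i) <= 3 * c * L%:R ->
  1 - kappa <= mD (A (j + L)).
Proof.
move=> jT hG.
have h1 : l1 (dv (sv (j + L)) (Q (j + L))) <=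
    2 * (c0 * q ^+ L) + 3 * e * L%:R + 6 * c * L%:R.
  rewrite -[dv _ (Q (j + L))](subrK (dv (sv j) (Q j) *m M ^+ L)).
  apply: le_trans (l1D _ _) _.
  have := uoc_set_mixing jT; rewrite big_split /= sumr_const card_ord -mulr_sumr -mulr_natr.
  have := mix L (dv_sum mu1 (sv j) (Q j)).
  have := l1_dv mu0 mu1 (sv j) (Q j).
  have := mD_le1 (R:=R) N0 (Q j).
  by move: c0q; nra.
have dis : [disjoint A (j + L) & Q (j + L)].
  by rewrite disjoint_sym finset.disjoints_subset; exact: Qdisj.
(* If D^OL with D^pi added has slack at least [erd], maximality gives m(D^pi) <= erd. Otherwise
   subtracting the slack of D^OL, or using that D^OL is empty, leaves eta m(D^pi) below the norm of
   its deviation plus at most 2 e. *)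
have hm : eta * mD (Q (j + L)) <= cu * l1 (dv (sv (j + L)) (Q (j + L))) + (2 + eta) * e.
  have lq := l1_ge0 (dv (sv (j + L)) (Q (j + L))).
  have [h|h] := leP erd (slack (sv (j + L)) (A (j + L) :|: Q (j + L))).
    have := Amax jT (finset.subsetUl _ _) h; rewrite mDU //.
    by move: erd0 e0 eta0 cu0; nra.
  move: h; rewrite slackE mDU // dvU //.
  have := nmD (dv (sv (j + L)) (A (j + L))) (dv (sv (j + L)) (Q (j + L))).
  have := nm_l1 (dv (sv (j + L)) (Q (j + L))).
  have [|A0] := Afeas jT; first by rewrite slackE; move: erd0 efe0 e0 eta0; nra.
  rewrite A0 mD0 dv0.
  have : nm 0 <= 0 by apply: le_trans (nm_l1 0) _; rewrite /l1 big1 ?mulr0 // => s _; rewrite mxE normr0.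
  by move: erd0 efe0 e0 eta0; nra.
have := Qcard jT => /andP[_ h2].
have h3 : cu * l1 (dv (sv (j + L)) (Q (j + L))) <=
   cu * (2 * (c0 * q ^+ L) + 3 * e * L%:R + 6 * c * L%:R) by rewrite ler_pM2l.
(* D^pi is a fraction beta of the complement of D^OL up to e, so [C2] turns the bound on D^pi into
   one on the complement. *)
have h4 : eta * (beta * (1 - mD (A (j + L)))) <= eta * (beta * kappa).
  have : eta * (beta * (1 - mD (A (j + L)))) <= eta * (mD (Q (j + L)) + e) by rewrite ler_pM2l.
  by move: hm h3 C2; lra.
have eb : 0 < eta * beta by rewrite mulr_gt0 //; case/andP: beta01.
by move: h4; rewrite !mulrA ler_pM2l //; lra.
Qed.

(** [C1] says that the bound of [olc_slack_persists] is nonnegative at mass c; that bound increases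
    with the mass. *)
Lemma olc_set_grows j : (j.+1 < T)%N -> c <= mD (A j) -> A j \subset A j.+1.
Proof.
move=> jT cm; apply: Agrow => //; apply: le_trans (olc_slack_persists (ltnW jT) cm).
have : 0 <= (1 - rho) * (eta * (mD (A j) - c)).
  by rewrite !mulr_ge0 ?subr_ge0 ?(ltW eta0) //; case/andP: rho01 => _ /ltW.
by move: C1; lra.
Qed.

Lemma olc_set_grows_le s j : (s + j < T)%N -> c <= mD (A s) -> A s \subset A (s + j).
Proof.
move=> + cs; elim: j => [|j IH]; first by rewrite addn0.
rewrite addnS => jT; have h := IH (ltnW jT).
apply: (fintype.subset_trans (h)); apply: olc_set_grows => //; exact: le_trans cs (mDS _ h).
Qed.

(** At most L steps bring the mass to c, J windows of length L bring it to 1 - kappa, and one last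
    transition brings the slack of the full set above 0: this is the count in [T]. *)
Theorem good_path_feasible : 0 <= slack (sv T) [set: 'I_N].
Proof.
have L1 : (1 : R) <= L%:R by rewrite ler1n.
have LT k : (k <= L)%N -> (k < T)%N.
  by move=> kL; rewrite /T ltnS (leq_trans kL) // leq_pmulr.
(* If all masses stayed below c, then every [g] would be at most 3 c, and [mixing_window] would give
   a mass of at least 1/2. *)
have [s sL cs] : exists2 s, (s <= L)%N & c <= mD (A s).
  apply: contrapT => hno.
  have small k : (k <= L)%N -> mD (A k) <= c.
    by move=> kL; rewrite leNgt; apply/negP => h; apply: hno; exists k => //; exact: ltW.
  have : 1 - kappa <= mD (A (0 + L)).
    apply: mixing_window; first by rewrite add0n LT.
    rewrite mulr_natr -[in leRHS](card_ord L) -sumr_const; apply: ler_sum => i _; rewrite add0n.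
    have := small i (ltnW (ltn_ord i)); have := small i.+1 (ltn_ord i).
    have := mDS (R:=R) N0 (finset.subsetDl (A i) (A i.+1)).
    have := mDS (R:=R) N0 (finset.subsetDl (A i.+1) (A i)).
    by rewrite /g; lra.
  by have := small L (leqnn L); rewrite add0n; move: kap cpos; lra.
have key i : (s + L * i < T)%N -> i%:R * c <= mD (A (s + L * i)) \/ 1 - kappa <= mD (A (s + L * i)).
  elim: i => [|i IH] iT; first by left; rewrite mul0r mD_ge0.
  move: iT; rewrite mulnS addnCA addnC => iT.
  have iT' : (s + L * i < T)%N by apply: leq_ltn_trans iT; rewrite leq_addr.
  have ci : c <= mD (A (s + L * i)) by apply: (le_trans cs (mDS N0 (olc_set_grows_le _ _))).
  have mono k : (k <= L)%N -> c <= mD (A (s + L * i + k)).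
    move=> kL; have kT : (s + L * i + k < T)%N by apply: leq_ltn_trans iT; rewrite leq_add2l.
    by apply: (le_trans ci (mDS N0 (olc_set_grows_le _ _))).
  have [h|h] := IH iT'; last by right; apply: (le_trans h (mDS N0 (olc_set_grows_le _ _))).
  have [h2|h2] := leP c (mD (A (s + L * i + L)) - mD (A (s + L * i))).
    by left; rewrite -natr1; lra.
  (* The sets are nested here, so the [g] telescope to twice the gain, and the gain is less than
     c. *)
  right; apply: mixing_window => //.
  have -> : \sum_(k < L) g (s + L * i + k) =
     2 * (mD (A (s + L * i + L)) - mD (A (s + L * i))).
    rewrite (eq_bigr (fun k : 'I_L => 2 * (mD (A (s + L * i + k.+1)) - mD (A (s + L * i + k))))).
      rewrite -mulr_sumr; congr (_ * _).
      rewrite -(big_mkord xpredT (fun k => mD (A (s + L * i + k.+1)) - mD (A (s + L * i + k)))).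
      by rewrite (telescope_sumr (fun k => mD (A (s + L * i + k)))) // addn0.
    move=> k _; rewrite /g addnS.
    have kT : ((s + L * i + k).+1 < T)%N.
      by apply: leq_ltn_trans iT; rewrite -addnS leq_add2l.
    have sub := olc_set_grows kT (mono k (ltnW (ltn_ord k))).
    rewrite mDD (finset.setIidPr sub).
    by move: (sub); rewrite -finset.setD_eq0 => /eqP ->; rewrite mD0 addr0.
  by move: cpos; nra.
have sJ : (s + L * J <= T.-1)%N by rewrite /T /= mulnS leq_add2r.
have fin : 1 - kappa <= mD (A T.-1).
  have h := key J (leq_ltn_trans sJ (ltnSn _)).
  have cJ : c <= mD (A (s + L * J)).
    by apply: (le_trans cs (mDS N0 (olc_set_grows_le _ _))) => //; exact: leq_ltn_trans sJ _.
  have : mD (A (s + L * J)) <= mD (A T.-1).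
    by apply: mDS => //; rewrite -(subnKC sJ); apply: olc_set_grows_le => //; rewrite subnKC.
  by case/andP: kap => k0 _; case: h => h; move: Jc h k0; lra.
have TT : (T.-1 < T)%N by [].
have cT : c <= mD (A T.-1) by move: cpos kap fin; lra.
(* The last decision is the one at T - 1, and the slack is taken one transition later. Adding the
   complement costs at most 2 cu kappa in norm, which [C3] affords. *)
have := olc_slack_persists TT cT; rewrite -[T.-1.+1]/T !slackE.
have -> : [set: 'I_N] = A T.-1 :|: ~: A T.-1 by rewrite finset.setUCr.
have dis : [disjoint A T.-1 & ~: A T.-1] by rewrite -setI_eq0 finset.setICr.
rewrite dvU // mDU //.
have mC : mD (~: A T.-1) = 1 - mD (A T.-1).
  by rewrite -(mDT (R:=R) N0) -finset.setTD mDD finset.setTI.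
have := nmD (dv (sv T) (A T.-1)) (dv (sv T) (~: A T.-1)).
have := nm_l1 (dv (sv T) (~: A T.-1)).
have := l1_dv mu0 mu1 (sv T) (~: A T.-1).
rewrite mC => h1 h2 h3 h4.
have h5 : cu * l1 (dv (sv T) (~: A T.-1)) <= cu * (2 * kappa).
  by rewrite ler_pM2l //; move: fin; lra.
have h6 : (1 - rho) * (eta / 2 - e) <= (1 - rho) * (eta * mD (A T.-1) - e).
  by rewrite ler_wpM2l; move: rho01 fin kap eta0; nra.
have h7 : 0 <= eta * (1 - mD (A T.-1)).
  by rewrite mulr_ge0 ?(ltW eta0) // subr_ge0 mD_le1.
by move: C3 h4 h5 h6 h7 h2 h3; lra.
Qed.
End Path.

(** * Concentration and Cesaro limits *)

(** From exp(-x) >= 1 - x, because (1 - x)(1 + x + 2 x^2) = 1 + x^2 (1 - 2 x). *)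
Lemma expR_le_quad (R : realType) (x : R) : x <= 1/2 -> expR x <= 1 + x + 2 * x ^+ 2.
Proof.
move=> x2; have h := expR_ge1Dx (- x).
have x1 : 0 < 1 - x by lra.
have h1 : (1 - x) * expR x <= 1.
  rewrite -[leRHS](expRxMexpNx_1 x) mulrC ler_pM2l ?expR_gt0 //; lra.
have h2 : 1 <= (1 - x) * (1 + x + 2 * x ^+ 2).
  have := sqr_ge0 x; rewrite expr2; nra.
by rewrite -(ler_pM2l x1); exact: le_trans h1 h2.
Qed.

Section Chernoff.
Context {R : realType} {n N : nat}.
Variables (p : 'I_N -> 'I_n -> R) (D : {set 'I_N}) (s : 'I_n).
Hypotheses (p0 : forall i s', 0 <= p i s') (p1 : forall i, \sum_s' p i s' = 1).

Let dev (f : {ffun 'I_N -> 'I_n}) : R := \sum_(i in D) ((f i == s)%:R - p i s).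

(** In the quadratic bound on the exponential the linear term has mean zero, and the deviation is at
    most 1 in modulus. *)
Lemma centered_mgf i h : `|h| <= 1/2 ->
  \sum_s' p i s' * expR (h * ((s' == s)%:R - p i s)) <= expR (2 * h ^+ 2).
Proof.
move=> hh; have pi1 : p i s <= 1.
  by rewrite -(p1 i) (bigD1 s) //= lerDl sumr_ge0.
apply: (@le_trans _ _ (1 + 2 * h ^+ 2)); last exact: expR_ge1Dx.
set z := fun s' => (s' == s)%:R - p i s.
have z1 s' : `|z s'| <= 1.
  rewrite /z ler_norml; have := p0 i s; move: pi1.
  by case: (s' == s) => /=; rewrite ?mulr1n ?mulr0n; lra.
apply: (@le_trans _ _ (\sum_s' (p i s' + h * (p i s' * z s') + 2 * h ^+ 2 * p i s'))).
  apply: ler_sum => s' _.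
  have hz : `|h * z s'| <= 1/2.
    by rewrite normrM; have := z1 s'; have := normr_ge0 h; have := normr_ge0 (z s'); nra.
  have := expR_le_quad (le_trans (ler_norm _) hz).
  have z2 : z s' ^+ 2 <= 1.
    by rewrite -real_normK ?num_real // expr_le1.
  have := p0 i s'; rewrite -/(z s') exprMn.
  set E := expR _; move=> q0 hE; have := sqr_ge0 h; set h2 := h ^+ 2 in hE * => h20.
  apply: (@le_trans _ _ (p i s' * (1 + h * z s' + 2 * h2))).
    rewrite ler_wpM2l //; apply: le_trans hE _.
    by rewrite lerD2l ler_wpM2l // ler_piMr.
  by rewrite le_eqVlt; apply/orP; left; apply/eqP; ring.
rewrite !big_split /= -!mulr_sumr p1.
have -> : \sum_s' p i s' * z s' = 0.
  rewrite (eq_bigr (fun s' => p i s' * (s' == s)%:R - p i s' * p i s)); last first.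
    by move=> s' _; rewrite mulrBr.
  rewrite sumrB -mulr_suml p1 mul1r (bigD1 s) //= eqxx mulr1 big1 ?addr0 ?subrr //.
  by move=> s' /negbTE ->; rewrite mulr0.
by rewrite mulr0 addr0 mulr1.
Qed.

(** Independence factors the expectation over the arms; arms outside D contribute 1, which is within
    the same bound. *)
Lemma dev_mgf h : `|h| <= 1/2 ->
  \sum_(f : {ffun 'I_N -> 'I_n}) (\prod_i p i (f i)) * expR (h * dev f)
    <= expR (2 * h ^+ 2 * N%:R).
Proof.
move=> hh.
rewrite (eq_bigr (fun f : {ffun 'I_N -> 'I_n} => \prod_i (p i (f i) *
   expR (if i \in D then h * ((f i == s)%:R - p i s) else 0)))); last first.
  move=> f _; rewrite big_split /=; congr (_ * _).
  by rewrite -expR_sum -big_mkcond mulr_sumr.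
rewrite -(bigA_distr_bigA (fun i s' => p i s' *
   expR (if i \in D then h * ((s' == s)%:R - p i s) else 0))) /=.
have -> : expR (2 * h ^+ 2 * N%:R) = \prod_(i < N) expR (2 * h ^+ 2).
  by rewrite -expR_sum sumr_const card_ord mulr_natr.
apply: ler_prod => i _; apply/andP; split.
  by apply: sumr_ge0 => s' _; rewrite mulr_ge0 ?expR_ge0.
case: (i \in D); first exact: centered_mgf.
rewrite expR0 -mulr_suml p1 mulr1 -expR0 ler_expR mulr_ge0 // sqr_ge0 //.
Qed.

Lemma chernoff eps : 0 < eps <= 1 ->
  \sum_(f : {ffun 'I_N -> 'I_n} | eps * N%:R < `|dev f|) \prod_i p i (f i)
    <= 2 * expR (- (eps ^+ 2 / 8) * N%:R).
Proof.
(* This h minimises 2 h^2 - h eps, with value - eps^2 / 8; eps <= 1 keeps it in the range of the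
   quadratic bound. *)
move=> /andP[e0 e1]; pose h := eps / 4.
have h2 : `|h| <= 1/2 by rewrite /h ger0_norm; lra.
have h0 : 0 < h by rewrite /h; lra.
have q0 f : 0 <= \prod_i p i (f i) by apply: prodr_ge0.
apply: (@le_trans _ _ (\sum_(f : {ffun 'I_N -> 'I_n}) (\prod_i p i (f i)) *
   ((expR (h * dev f) + expR (- h * dev f)) * expR (- h * (eps * N%:R))))).
  rewrite big_mkcond ler_sum // => f _; case: ifP => hf; last first.
    by rewrite mulr_ge0 // mulr_ge0 ?expR_ge0 // addr_ge0 ?expR_ge0.
  apply: ler_peMr => //; rewrite mulrDl -!expRD.
  have := hf; rewrite ltr_normr => /orP[hd|hd].
    apply: ler_wpDr; rewrite ?expR_ge0 // -[leLHS]expR0 ler_expR mulNr subr_ge0 ler_pM2l //.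
    exact: ltW.
  apply: ler_wpDl; rewrite ?expR_ge0 // -[leLHS]expR0 ler_expR !mulNr -mulrN subr_ge0 ler_pM2l //.
  exact: ltW.
rewrite (eq_bigr (fun f : {ffun 'I_N -> 'I_n} => ((\prod_i p i (f i)) * expR (h * dev f) +
   (\prod_i p i (f i)) * expR (- h * dev f)) * expR (- h * (eps * N%:R)))); last first.
  by move=> f _; rewrite -mulrDr mulrA.
rewrite -mulr_suml big_split /=.
have m1 := dev_mgf h2; have m2 := @dev_mgf (- h); rewrite normrN sqrrN in m2.
apply: (@le_trans _ _ ((2 * expR (2 * h ^+ 2 * N%:R)) * expR (- h * (eps * N%:R)))).
  by rewrite ler_wpM2r ?expR_ge0 //; have := m2 h2; lra.
by rewrite -mulrA -expRD ler_pM2l // ler_expR /h le_eqVlt; apply/orP; left; apply/eqP; field.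
Qed.
End Chernoff.

(** * Cesaro averages of a finite stochastic matrix *)

Section Cesaro.
Local Open Scope classical_set_scope.
Local Open Scope ring_scope.
Context {R : realType} {m : nat}.
Variable M : 'M[R]_m.
Hypotheses (M0 : forall i j, 0 <= M i j) (M1 : forall i, \sum_j M i j = 1).

Let subE (u v : 'cV[R]_m) i : (u - v) i 0 = u i 0 - v i 0.
Proof. by rewrite !mxE. Qed.

Lemma stoch_sup_le (u : 'cV[R]_m) b t : (forall i, `|u i 0| <= b) ->
  forall i, `|(M ^+ t *m u) i 0| <= b.
Proof.
move=> ub; elim: t => [|t IH] i; first by rewrite expr0 mul1mx.
rewrite exprS -mulmxE -mulmxA mxE; apply: le_trans (ler_norm_sum _ _ _) _.
rewrite -[leRHS]mul1r -(M1 i) mulr_suml; apply: ler_sum => j _.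
by rewrite normrM ger0_norm // ler_wpM2l.
Qed.

Lemma bounded_multiples (x b : R) : (forall T : nat, T%:R * `|x| <= b) -> x = 0.
Proof.
move=> h; apply/eqP; rewrite -normr_le0 leNgt; apply/negP => x0.
have b0 : 0 <= b by apply: le_trans (h 0%N); rewrite mul0r.
have := h (Num.bound (b / `|x|)); apply/negP; rewrite -ltNge -ltr_pdivrMr //.
by apply: archi_boundP; rewrite divr_ge0.
Qed.

Lemma telescope_stoch (u x : 'cV[R]_m) T : x = u - M *m u ->
  \sum_(t < T) M ^+ t *m x = u - M ^+ T *m u.
Proof.
move=> ->; elim: T => [|T IH]; first by rewrite big_ord0 expr0 mul1mx subrr.
rewrite big_ord_recr /= IH mulmxBr exprSr -mulmxE mulmxA.
by rewrite addrA subrK.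
Qed.

(* The sums \sum_(t < m) M^t x = m x stay bounded since they telescope. *)
Lemma fixed_coboundary0 (u x : 'cV[R]_m) : x = u - M *m u -> M *m x = x -> x = 0.
Proof.
move=> xu Mx.
have Mtx t : M ^+ t *m x = x.
  by elim: t => [|t IH]; rewrite ?expr0 ?mul1mx // exprSr -mulmxE -mulmxA Mx.
apply/colP => i; rewrite [RHS]mxE.
pose b := \sum_i `|u i 0|.
have ub j : `|u j 0| <= b by rewrite /b (bigD1 j) //= lerDl sumr_ge0.
apply: (@bounded_multiples _ (b + b)) => T.
have := telescope_stoch T xu; rewrite (eq_bigr (fun=> x)); last by move=> t _; exact: Mtx.
rewrite sumr_const card_ord => /colP/(_ i) h.
have <- : `|(x *+ T) i 0| = T%:R * `|x i 0|.
  have -> : (x *+ T) i 0 = T%:R * x i 0 by rewrite -scaler_nat mxE.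
  by rewrite normrM ger0_norm.
rewrite h subE; apply: le_trans (ler_normB _ _) _.
by apply: lerD => //; exact: stoch_sup_le.
Qed.

(** The kernel and the image of 1 - M meet only in 0 by [fixed_coboundary0], so by rank-nullity they
    span. Transposes move the statement to row spaces. *)
Lemma fixed_plus_coboundary (g : 'cV[R]_m) : exists k u : 'cV[R]_m,
  M *m k = k /\ g = k + (u - M *m u).
Proof.
pose B := (1%:M - M)^T.
have BE (w : 'rV_m) : (w *m B)^T = w^T - M *m w^T.
  by rewrite trmx_mul trmxK mulmxBl mul1mx.
have dis : (kermx B :&: B = 0)%MS.
  apply/eqP/rowV0P => w; rewrite sub_capmx => /andP[/sub_kermxP wB /submxP[u wu]].
  apply: trmx_inj; rewrite trmx0; apply: (@fixed_coboundary0 u^T).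
    by rewrite -BE -wu.
  by apply/eqP; rewrite eq_sym -subr_eq0 -BE wB trmx0.
have full : row_full (kermx B + B)%MS.
  rewrite /row_full (mxrank_disjoint_sum dis) mxrank_ker subnK ?rank_leq_col //.
have [[a b] gE] := sub_addsmxP (submx_full g^T full).
exists (a *m kermx B)^T, b^T; split.
  by apply/eqP; rewrite eq_sym -subr_eq0 -BE -mulmxA mulmx_ker mulmx0 trmx0.
by rewrite -BE -linearD /= -gE trmxK.
Qed.

Lemma inv_nat_bounded_cvg0 (b : nat -> R) c : (forall T, `|b T| <= c) ->
  (fun T : nat => T%:R^-1 * b T) @ \oo --> 0.
Proof.
move=> hb; have c0 : 0 <= c by exact: le_trans (hb 0%N).
apply/cvgrPdist_le => e e0; near=> T.
have T0 : 0 < T%:R :> R by near: T; exact: nbhs_infty_gtr.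
rewrite sub0r normrN normrM normfV (ger0_norm (ltW T0)) mulrC ler_pdivrMr //.
apply: le_trans (hb T) _; rewrite mulrC -ler_pdivrMr //.
by near: T; exact: nbhs_infty_ger.
Unshelve. all: by end_near.
Qed.

(** [avg_reward] is a [limn], so bounds on finite averages pass to it only once convergence is
    known. The fixed part of g contributes a constant and the coboundary part O(1/T). *)
Lemma cesaro_stoch (d : 'rV[R]_m) (g : 'cV[R]_m) :
  cvgn (fun T : nat => T%:R^-1 * \sum_(t < T) (d *m M ^+ t *m g) 0 0).
Proof.
have [k [u [Mk gE]]] := fixed_plus_coboundary g.
have Mtk t : M ^+ t *m k = k.
  by elim: t => [|t IH]; rewrite ?expr0 ?mul1mx // exprSr -mulmxE -mulmxA Mk.
pose b := \sum_i `|u i 0|.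
have ub j : `|u j 0| <= b by rewrite /b (bigD1 j) //= lerDl sumr_ge0.
pose bb T := (d *m (u - M ^+ T *m u)) 0 0.
have sumE T : \sum_(t < T) (d *m M ^+ t *m g) 0 0 = T%:R * (d *m k) 0 0 + bb T.
  rewrite /bb -(telescope_stoch T erefl) mulmx_sumr summxE.
  rewrite -[X in X%:R]card_ord mulr_natl -sumr_const -big_split /=.
  by apply: eq_bigr => t _; rewrite -mulmxA gE mulmxDr Mtk mulmxDr mxE.
have h0 : (fun T : nat => T%:R^-1 * bb T) @ \oo --> 0.
  apply: (@inv_nat_bounded_cvg0 _ (\sum_j `|d 0 j| * (b + b))) => T.
  rewrite /bb mxE; apply: le_trans (ler_norm_sum _ _ _) _; apply: ler_sum => j _.
  rewrite normrM ler_wpM2l // subE; apply: le_trans (ler_normB _ _) _.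
  by apply: lerD => //; exact: stoch_sup_le.
apply: (@cvgP _ _ ((d *m k) 0 0 + 0)).
apply: cvg_trans (cvgD (cvg_cst ((d *m k) 0 0)) h0).
apply: near_eq_cvg; near=> T.
have T0 : T%:R != 0 :> R.
  by rewrite gt_eqF //; near: T; exact: nbhs_infty_gtr.
by rewrite sumE mulrDr mulKf.
Unshelve. all: by end_near.
Qed.
End Cesaro.

(** * One step of the policy *)

Section Rounding.
Context {R : realType}.

Lemma rr_neq0 (c : R) k : rr c k != 0 -> `|k%:~R - c| <= 1.
Proof.
have [-> _|h1] := eqVneq k (Num.ceil c).
  have := ceil_ge c; have := ceilB1_lt c; rewrite intrB ler_norml; lra.
have [-> _|h2] := eqVneq k (Num.floor c).
  have := floor_le c; have := floorD1_gt c; rewrite intrD ler_norml; lra.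
by rewrite /rr (negbTE h1) (negbTE h2) addr0 eqxx.
Qed.

Lemma rr_nat (k : nat) : rr (k%:R : R) k%:Z = 1.
Proof.
rewrite /rr -[k%:R]/(k%:Z%:~R) intrKfloor intrKceil eqxx; ring.
Qed.

Lemma ceil_floor_mean (c : R) :
  (c - (Num.floor c)%:~R) * (Num.ceil c)%:~R
    + (1 - (c - (Num.floor c)%:~R)) * (Num.floor c)%:~R = c.
Proof.
have [ci|ci] := boolP (c \is a Num.int).
  have /intrP[z ->] := ci; rewrite intrKfloor intrKceil; ring.
have -> : Num.ceil c = Num.floor c + 1.
  by rewrite ceil_floor ci.
rewrite intrD; ring.
Qed.

(** Counts are naturals at most N whereas [rr] is a law on integers; the range of c places its floor
    and ceiling among them. *)
Lemma rr_expect N (c : R) (f : nat -> R) : 0 <= c <= N%:R ->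
  \sum_(k < N.+1) rr c k%:Z * f k =
  (c - (Num.floor c)%:~R) * f `|Num.ceil c|%N
    + (1 - (c - (Num.floor c)%:~R)) * f `|Num.floor c|%N.
Proof.
move=> /andP[c0 cN].
have one (z : int) (w : R) : 0 <= z -> (z <= N%:Z)%R ->
    \sum_(k < N.+1) (if k%:Z == z then w else 0) * f k = w * f `|z|%N.
  case: z => // z _ zN; have zN' : (z < N.+1)%N by [].
  rewrite (bigD1 (Ordinal zN')) //= eqxx big1 ?addr0 // => k kz.
  case: eqP => [[e]|_]; last by rewrite mul0r.
  by move: kz; rewrite -val_eqE /= e eqxx.
rewrite -!one; first by rewrite -big_split /=; apply: eq_bigr => k _; rewrite mulrDl.
- by rewrite floor_ge0.
- by rewrite -(ler_int R); apply: le_trans (floor_le c) cN.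
- by rewrite -(ler_int R); apply: le_trans c0 (ceil_ge c).
- by rewrite ceil_le_int.
Qed.
End Rounding.

Section Arms.
Context {R : realType} {n N : nat}.
Implicit Types (sv : svec (n:=n) N) (a : avec N) (D : {set 'I_N}).

Lemma cntE sv D s : (cnt sv D s)%:R = \sum_(i in D) ((sv i == s)%:R : R).
Proof.
rewrite /cnt -sum1_card natr_sum big_mkcond [RHS]big_mkcond.
by apply: eq_bigr => i _; rewrite !inE; case: (i \in D) => //=; case: (_ == _).
Qed.

Lemma cnt_actE sv a D s :
  (cnt_act sv a D s)%:R = \sum_(i in D) (((sv i == s) && a i)%:R : R).
Proof.
rewrite /cnt_act -sum1_card natr_sum big_mkcond [RHS]big_mkcond.
by apply: eq_bigr => i _; rewrite !inE; case: (i \in D) => //=; case: (_ && _).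
Qed.

Lemma cnt_act_sum sv a D : (\sum_s cnt_act sv a D s)%N = #|[set i in D | a i]|.
Proof.
rewrite -sum1_card (partition_big sv xpredT) //=; apply: eq_bigr => s _.
rewrite /cnt_act -sum1_card; apply: eq_bigl => i; rewrite !inE.
by case: (i \in D); case: (a i); case: (_ == _).
Qed.

Lemma cnt_act_le sv a D s : (cnt_act sv a D s <= cnt sv D s)%N.
Proof.
by apply: subset_leq_card; apply/fintype.subsetP => i; rewrite !inE => /and3P[-> ->].
Qed.

Lemma sum_arms sv a D (f : 'I_n -> bool -> R) :
  \sum_(i in D) f (sv i) (a i) =
  \sum_s (((cnt sv D s)%:R - (cnt_act sv a D s)%:R) * f s false
    + (cnt_act sv a D s)%:R * f s true).
Proof.
under [RHS]eq_bigr do rewrite cntE cnt_actE -sumrB !mulr_suml -big_split /=.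
rewrite exchange_big /=; apply: eq_bigr => i _.
rewrite (bigD1 (sv i)) //= eqxx /= big1 ?addr0; last first.
  by move=> s /negbTE; rewrite eq_sym => -> /=; rewrite subrr !mul0r addr0.
by case: (a i); rewrite /= ?subrr ?subr0 ?mul0r ?mul1r ?add0r ?addr0.
Qed.
End Arms.

Section OneStep.
Context {R : realType} {n : nat}.
Variables (P : 'I_n -> bool -> 'I_n -> R) (alpha : R).
Variables (y : 'I_n -> bool -> R) (st : 'I_n).
Hypotheses (Pok : kernel_ok P) (yfeas : lp_feasible P alpha y)
  (A2 : assumption2 y st).
Variables (N : nat) (eta efe erd : R).
Hypothesis (N0 : (0 < N)%N).
Variables (sv : svec (n:=n) N) (Ap Qp : {set 'I_N}) (q : dec N -> R).
Hypothesis val : valid_at P alpha y st eta efe erd (sv, Ap, Qp) q.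

Let NR : 0 < N%:R :> R. Proof. by rewrite ltr0n. Qed.

(** The activation numbers of OLC before rounding; [st] receives what remains of the budget. *)
Definition olc_target (D : {set 'I_N}) (s : 'I_n) : R :=
  if s == st then alpha * #|D|%:R - \sum_(s' | s' != st) pibar y true s' * (cnt sv D s')%:R
  else pibar y true s * (cnt sv D s)%:R.

Lemma olc_target_sum D : \sum_s olc_target D s = alpha * #|D|%:R.
Proof.
rewrite (bigD1 st) //= /olc_target eqxx.
rewrite [X in _ + X](eq_bigr (fun s => pibar y true s * (cnt sv D s)%:R)) ?subrK //.
by move=> s /negbTE ->.
Qed.

(** A decision of positive probability makes the left side of the joint law positive, so no factor
    [rr] vanishes at the observed counts. *)
Lemma rounding_dev A Q a : 0 < q (A, Q, a) ->
  [/\ `|#|[set i in A | a i]|%:R - alpha * #|A|%:R| <= 1,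
      (forall s, Sempty y s -> `|(cnt_act sv a A s)%:R - (cnt sv A s)%:R / 2| <= 1 :> R)
    & (forall s, `|((cnt_act sv a Q s)%:R : R) - pibar y true s * (cnt sv Q s)%:R| <= 1 :> R)].
Proof.
move=> qp; case: val => q0 _ _ /(_ A Q (#|[set i in A | a i]|%:Z)
  (fun s => (cnt_act sv a A s)%:Z) (fun s => (cnt_act sv a Q s)%:Z)).
set lhs := \sum_(b : avec N | _) _ => h.
have lhs0 : 0 < lhs.
  rewrite /lhs (bigD1 a) /=; last first.
    by rewrite eqxx /=; apply/andP; split; apply/fintype.forallP => s; rewrite eqxx ?implybT.
  by rewrite ltr_pwDl // sumr_ge0.
move: lhs0; rewrite h => hp; have := lt0r_neq0 hp.
rewrite !mulf_eq0 !negb_or => /andP[/andP[/andP[_ h1] h2] h3].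
split=> [|s se|s]; first by have := rr_neq0 h1.
- move/prodf_neq0: h2 => /(_ s se) /rr_neq0 //.
- move/prodf_neq0: h3 => /(_ s isT) /rr_neq0 //.
Qed.

(** Each state other than [st] is off by at most 1. In [st] the error is the rounding of the budget
    minus the other errors, so at most 1 + n. *)
Lemma olc_dev A Q a : 0 < q (A, Q, a) ->
  \sum_s `|(cnt_act sv a A s)%:R - olc_target A s| <= 2 * n%:R + 1.
Proof.
move=> qp; have [h1 h2 _] := rounding_dev qp.
case: val => _ _ /(_ _ qp) [_ _ hp hm _] _.
have each s : s != st -> `|(cnt_act sv a A s)%:R - olc_target A s| <= 1.
  move=> ss; rewrite /olc_target (negbTE ss).
  have [e|sp|sm|se] := state_cases yfeas s A2; first by rewrite e eqxx in ss.
  - rewrite (Splus_pibar sp) mul1r (_ : cnt_act sv a A s = cnt sv A s) ?subrr ?normr0 //.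
    apply: eq_card => i; rewrite !inE; case iA : (i \in A) => //=.
    by case: eqP => //= e; rewrite hp // e.
  - rewrite (Sminus_pibar sm) mul0r (_ : cnt_act sv a A s = 0%N) ?subrr ?normr0 //.
    apply/eqP; rewrite cards_eq0; apply/eqP/setP => i; rewrite !inE; case iA : (i \in A) => //=.
    by case: eqP => //= e; apply/negbTE/hm => //; rewrite e.
  - by rewrite (Sempty_pibar se) mulrC; exact: h2.
set S := \sum_(s | s != st) `|(cnt_act sv a A s)%:R - olc_target A s|.
have hS : S <= n%:R.
  apply: (@le_trans _ _ (\sum_(s | s != st) 1)); first exact: ler_sum.
  by rewrite sumr_const ler_nat -[leqRHS]card_ord max_card.
have hst : `|(cnt_act sv a A st)%:R - olc_target A st| <= 1 + S.
  have -> : (cnt_act sv a A st)%:R - olc_target A st =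
     (#|[set i in A | a i]|%:R - alpha * #|A|%:R)
      - \sum_(s | s != st) ((cnt_act sv a A s)%:R - olc_target A s).
    rewrite -(cnt_act_sum sv) natr_sum -(olc_target_sum A) sumrB.
    rewrite (bigD1 st) //= [X in _ - X - _](bigD1 st) //=; ring.
  apply: le_trans (ler_normB _ _) _; apply: lerD => //; exact: ler_norm_sum.
rewrite (bigD1 st) //= -/S; lra.
Qed.

Lemma uoc_dev A Q a : 0 < q (A, Q, a) ->
  \sum_s `|(cnt_act sv a Q s)%:R - pibar y true s * (cnt sv Q s)%:R| <= n%:R.
Proof.
move=> /rounding_dev[_ _ h]; apply: (@le_trans _ _ (\sum_(s < n) 1)); first exact: ler_sum.
by rewrite sumr_const card_ord.
Qed.

Definition noise (sv' : svec (n:=n) N) (a : avec N) (D : {set 'I_N}) (s : 'I_n) : R :=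
  \sum_(i in D) ((sv' i == s)%:R - P (sv i) (a i) s).

Lemma flow_arms a D s :
  flow P (xD sv D 0) (fun s => (cnt_act sv a D s)%:R / N%:R) 0 s
   = (\sum_(i in D) P (sv i) (a i) s) / N%:R.
Proof.
rewrite (sum_arms sv a D (fun s1 b => P s1 b s)) mulr_suml mxE.
by apply: eq_bigr => s1 _; rewrite mxE; ring.
Qed.

Lemma l1_noise (sv' : svec (n:=n) N) a D eps :
  (forall s, `|noise sv' a D s| <= eps * N%:R) ->
  l1 (xD sv' D - flow P (xD sv D 0) (fun s => (cnt_act sv a D s)%:R / N%:R)) <= n%:R * eps.
Proof.
move=> h; apply: l1_le_const => s.
have -> : (xD sv' D - flow P (xD sv D 0) (fun s => (cnt_act sv a D s)%:R / N%:R)) 0 s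
   = noise sv' a D s / N%:R.
  have -> (u v : 'rV[R]_n) : (u - v) 0 s = u 0 s - v 0 s by rewrite !mxE.
  by rewrite flow_arms mxE cntE -mulrBl -sumrB.
by rewrite normrM normfV (ger0_norm (ltW NR)) ler_pdivrMr.
Qed.

Lemma flow_olc_target (A : {set 'I_N}) :
  flow P (xD sv A 0) (fun s => olc_target A s / N%:R) - mD (R:=R) A *: mustar y
   = dv y sv A *m Phi P alpha y st.
Proof.
apply: (flow_OLC yfeas).
- by move=> s ss; rewrite /olc_target (negbTE ss) mxE mulrA.
- exact: xD_sum.
- by rewrite -mulr_suml olc_target_sum mulrA.
Qed.

Lemma l1_scaled_dev (t t' : 'I_n -> R) b : \sum_s `|t s - t' s| <= b ->
  2 * \sum_s `|t s / N%:R - t' s / N%:R| <= 2 * b / N%:R.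
Proof.
move=> h; rewrite -mulrA ler_pM2l // (eq_bigr (fun s => `|t s - t' s| / N%:R)).
  by rewrite -mulr_suml ler_pM2r // invr_gt0.
by move=> s _; rewrite -mulrBl normrM normfV (ger0_norm (ltW NR)).
Qed.

(** The error splits into the sampling noise of the transitions and the effect on the mean flow of
    rounding the activation counts. *)
Lemma olc_step A Q a (sv' : svec (n:=n) N) eps : 0 < q (A, Q, a) ->
  (forall s, `|noise sv' a A s| <= eps * N%:R) ->
  l1 (dv y sv' A - dv y sv A *m Phi P alpha y st) <= n%:R * eps + 2 * (2 * n%:R + 1) / N%:R.
Proof.
move=> qp hn; rewrite -flow_olc_target.
set f1 := flow _ _ _; set f2 := flow P (xD sv A 0) (fun s => (cnt_act sv a A s)%:R / N%:R).
have -> : dv y sv' A - (f1 - mD (R:=R) A *: mustar y) = (xD sv' A - f2) + (f2 - f1).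
  by apply/rowP => s; rewrite !mxE; ring.
apply: le_trans (l1D _ _) _; apply: lerD; first exact: l1_noise.
apply: le_trans (l1_flow Pok _ _ _) _; apply: l1_scaled_dev; exact: olc_dev qp.
Qed.

Lemma uoc_step A Q a (sv' : svec (n:=n) N) eps : 0 < q (A, Q, a) ->
  (forall s, `|noise sv' a Q s| <= eps * N%:R) ->
  l1 (dv y sv' Q - dv y sv Q *m Ppi P y) <= n%:R * eps + 2 * n%:R / N%:R.
Proof.
move=> qp hn; rewrite /dv mulmxBl -scalemxAl (mustar_Ppi yfeas) -(flow_UOC P y).
set f1 := flow _ _ _; set f2 := flow P (xD sv Q 0) (fun s => (cnt_act sv a Q s)%:R / N%:R).
have -> : xD sv' Q - mD (R:=R) Q *: mustar y - (f1 - mD (R:=R) Q *: mustar y)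
     = (xD sv' Q - f2) + (f2 - f1).
  by apply/rowP => s; rewrite !mxE; ring.
apply: le_trans (l1D _ _) _; apply: lerD; first exact: l1_noise.
apply: le_trans (l1_flow Pok _ _ _) _.
rewrite (eq_bigr (fun s => `|(cnt_act sv a Q s)%:R / N%:R
    - (pibar y true s * (cnt sv Q s)%:R) / N%:R|)); last first.
  by move=> s _; rewrite mxE mulrA.
by apply: l1_scaled_dev; exact: uoc_dev qp.
Qed.

Section FullSet.
Hypotheses (full : 0 <= slack P alpha y st eta efe sv [set: 'I_N])
  (aN : exists k : nat, alpha * N%:R = k%:R).

(** With D^OL = [N] the prescribed size of D^pi is at most beta times 0. *)
Lemma full_dec d : 0 < q d -> d.1 = ([set: 'I_N], finset.set0).
Proof.
case: d => [[A Q] a] qp; case: val => _ _ /(_ _ qp) [].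
rewrite full => -> [_ _ /andP[h _]] _ _ _ _ /=; congr pair.
apply/eqP; rewrite -cards_eq0; move: h.
by rewrite cardsT card_ord subnn mulr0 -[0]/(0%:R) ler_nat leqn0.
Qed.

Let w a := q ([set: 'I_N], finset.set0, a).

Lemma full_sum (f : dec N -> R) :
  \sum_d q d * f d = \sum_a w a * f ([set: 'I_N], finset.set0, a).
Proof.
case: val => q0 _ _ _.
rewrite [LHS](eq_bigr (fun d => q (d.1, d.2) * f (d.1, d.2))); last by case.
rewrite -(pair_bigA _ (fun p a => q (p, a) * f (p, a))) /=.
rewrite (bigD1 ([set: 'I_N], finset.set0)) //= [X in _ + X]big1 ?addr0 // => p pn.
apply: big1 => a _; have [e|e] := eqVneq (q (p, a)) 0; first by rewrite e mul0r.
have qp : 0 < q (p, a) by rewrite lt_neqAle eq_sym e q0.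
by move: pn; rewrite -(full_dec qp) eqxx.
Qed.

Lemma full_mass : \sum_a w a = 1.
Proof.
case: val => _ <- _ _; have := full_sum (fun=> 1).
by under eq_bigr do rewrite mulr1; under [in RHS]eq_bigr do rewrite mulr1.
Qed.

(* When D^OL is everything, D^pi is empty and the target budget is the integer alpha N,
   so only the roundings in the states of Sempty remain. *)
Lemma full_law (k0 : 'I_n -> int) :
  \sum_(a | [forall s, Sempty y s ==> ((cnt_act sv a [set: 'I_N] s)%:Z == k0 s)]) w a
   = \prod_(s | Sempty y s) rr ((cnt sv [set: 'I_N] s)%:R / 2) (k0 s).
Proof.
have [k kE] := aN; case: val => q0 _ hv /(_ [set: 'I_N] finset.set0 k%:Z k0 (fun=> 0)).
have -> : \sum_a q ([set: 'I_N], finset.set0, a) = 1 by exact: full_mass.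
rewrite cardsT card_ord kE rr_nat !mul1r.
rewrite [X in _ * X]big1 ?mulr1 => [<-|s _]; last first.
  rewrite (_ : cnt _ _ _ = 0%N) ?mulr0; first exact: (rr_nat 0).
  by apply/eqP; rewrite cards_eq0; apply/eqP/setP => i; rewrite !inE.
rewrite [LHS]big_mkcond [RHS]big_mkcond; apply: eq_bigr => a _.
have [e|e] := eqVneq (w a) 0; first by rewrite -/(w a) e !if_same.
have qp : 0 < q ([set: 'I_N], finset.set0, a) by rewrite lt_neqAle eq_sym e q0.
have [_ _ _ _ ca] := hv _ qp.
have -> : #|[set i in [set: 'I_N] | a i]|%:Z == k%:Z.
  have /eqP := ca; rewrite kE eqr_nat => /eqP <-.
  by apply/eqP; congr Posz; apply: eq_card => i; rewrite !inE.
rewrite (_ : [forall s, (cnt_act sv a finset.set0 s)%:Z == 0]) ?andbT //.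
by apply/fintype.forallP => s; rewrite eqz_nat cards_eq0; apply/eqP/setP => i; rewrite !inE.
Qed.

(** Conditioning on the vector of counts in the states of [Sempty] turns the expectation into a
    product of one-state sums, by [full_law] and distributivity. All factors are 1 except the one at
    [s0], the mean of a randomized rounding. *)
Lemma Sempty_mean s0 : Sempty y s0 ->
  \sum_a w a * (cnt_act sv a [set: 'I_N] s0)%:R = (cnt sv [set: 'I_N] s0)%:R / 2.
Proof.
move=> se0; set X := [set: 'I_N].
have cN s : (cnt sv X s <= N)%N by rewrite -[leqRHS]card_ord max_card.
have caN a s : (cnt_act sv a X s < N.+1)%N by rewrite ltnS (leq_trans (cnt_act_le _ _ _ _)).
pose ka a : {ffun 'I_n -> 'I_N.+1} :=
  [ffun s => if Sempty y s then inord (cnt_act sv a X s) else ord0].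
(* Outside [Sempty] the coordinate is pinned to 0 by a point mass, so that the product runs over all
   states. *)
pose H s (k : 'I_N.+1) : R :=
  if Sempty y s then rr ((cnt sv X s)%:R / 2) k%:Z else (k == ord0)%:R.
rewrite (partition_big ka xpredT) //=.
rewrite (eq_bigr (fun phi : {ffun 'I_n -> 'I_N.+1} =>
    \prod_s (H s (phi s) * (if s == s0 then (phi s)%:R else 1)))).
  rewrite -(bigA_distr_bigA (fun s (k : 'I_N.+1) => H s k * (if s == s0 then k%:R else 1))) /=.
  rewrite (bigD1 s0) //= [X in _ * X]big1 ?mulr1; last first.
    move=> s ss; rewrite (negbTE ss); under eq_bigr do rewrite mulr1.
    rewrite /H; have [se|se] := boolP (Sempty y s).
      have hc : 0 <= ((cnt sv X s)%:R : R) / 2 <= (N%:R : R).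
        by have := cN s; rewrite -(ler_nat R) => h; have := ler0n R (cnt sv X s); lra.
      transitivity (\sum_(k < N.+1) rr ((cnt sv X s)%:R / 2 : R) k%:Z * 1).
        by apply: eq_bigr => k _; rewrite mulr1.
      rewrite (rr_expect (fun=> 1) hc); ring.
    by rewrite (bigD1 ord0) //= [X in _ + X]big1 ?addr0 // => k /negbTE ->.
  rewrite eqxx /H se0 (rr_expect (fun k => k%:R)).
    have c0 : 0 <= (cnt sv X s0)%:R / 2 :> R by rewrite divr_ge0.
    have ab (z : int) : 0 <= z -> `|z|%N%:R = z%:~R :> R by case: z.
    by rewrite !ab ?floor_ge0 ?ceil_floor_mean // -(ler_int R); apply: le_trans c0 (ceil_ge _).
  have := cN s0; rewrite -(ler_nat R) => h; have := ler0n R (cnt sv X s0).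
  by lra.
move=> phi _; rewrite big_split /=.
have -> : \prod_s (if s == s0 then (phi s)%:R else 1) = (phi s0)%:R :> R.
  by rewrite (bigD1 s0) //= eqxx big1 ?mulr1 // => s /negbTE ->.
rewrite (eq_bigr (fun a => w a * (phi s0)%:R)); last first.
  by move=> a /eqP <-; rewrite ffunE se0 inordK.
rewrite -mulr_suml; congr (_ * _).
rewrite (bigID (Sempty y)) /= (eq_bigr (fun s => rr ((cnt sv X s)%:R / 2) (phi s)%:Z)); last first.
  by move=> s se; rewrite /H se.
have [/fintype.forallP hz|/fintype.forallPn[s]] := boolP [forall s, ~~ Sempty y s ==> (phi s == ord0)].
  rewrite [X in _ * X]big1 ?mulr1; last first.
    by move=> s se; rewrite /H (negbTE se) (eqP (implyP (hz s) se)) eqxx.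
  rewrite -full_law; apply: eq_bigl => a; apply/eqP/fintype.forallP => [<- s|h].
    by apply/implyP => se; rewrite ffunE se inordK.
  apply/ffunP => s; rewrite ffunE; case: ifP => se.
    apply: val_inj; rewrite /= inordK //.
    by have := implyP (h s) se; rewrite eqz_nat => /eqP.
  by have := implyP (hz s); rewrite se => /(_ isT) /eqP.
rewrite negb_imply => /andP[se ps].
have Hs : H s (phi s) = 0 by rewrite /H (negbTE se) (negbTE ps).
rewrite [X in _ = _ * X](bigD1 s) //= Hs mul0r mulr0.
apply: big_pred0 => a; apply/eqP => e.
by move: ps; rewrite -e ffunE (negbTE se) eqxx.
Qed.

(** For [st] nothing is known about the activated count by itself; its mean follows by subtraction,
    since the total is exactly alpha N. *)
Lemma full_mean s :
  \sum_a w a * (cnt_act sv a [set: 'I_N] s)%:R = olc_target [set: 'I_N] s.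
Proof.
case: (val) => q0 _ hv _.
have weighted (c : R) (f : avec N -> R) : (forall a, 0 < w a -> f a = c) ->
    \sum_a w a * f a = c.
  move=> h; rewrite -[RHS]mul1r -full_mass mulr_suml; apply: eq_bigr => a _.
  have [->|e] := eqVneq (w a) 0; first by rewrite !mul0r.
  by rewrite h // lt_neqAle eq_sym e q0.
have other s1 : s1 != st ->
    \sum_a w a * (cnt_act sv a [set: 'I_N] s1)%:R = olc_target [set: 'I_N] s1.
  move=> ss; rewrite /olc_target (negbTE ss).
  have [e|sp|sm|se] := state_cases yfeas s1 A2; first by rewrite e eqxx in ss.
  - rewrite (Splus_pibar sp) mul1r; apply: weighted => a /hv [_ _ hp _ _]; congr (_%:R).
    apply: eq_card => i; rewrite !inE /=.
    by case: eqP => //= e; rewrite hp // ?inE // e.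
  - rewrite (Sminus_pibar sm) mul0r; apply: weighted => a /hv [_ _ _ hm _].
    rewrite (_ : cnt_act sv a _ s1 = 0%N) //.
    apply/eqP; rewrite cards_eq0; apply/eqP/setP => i; rewrite !inE /=.
    by case: eqP => //= e; apply/negbTE/hm => //; rewrite ?inE // e.
  - by rewrite (Sempty_pibar se) mulrC; exact: Sempty_mean.
have tot : \sum_s \sum_a w a * (cnt_act sv a [set: 'I_N] s)%:R = \sum_s olc_target [set: 'I_N] s.
  rewrite olc_target_sum exchange_big /=.
  under eq_bigr do rewrite -mulr_sumr -natr_sum cnt_act_sum.
  apply: weighted => a /hv [_ _ _ _ ca]; rewrite cardsT card_ord -ca; congr (_%:R).
  by apply: eq_card => i; rewrite !inE.
have [->|] := eqVneq s st; last exact: other.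
move: tot; rewrite (bigD1 st) //= [in RHS](bigD1 st) //=.
by rewrite (eq_bigr (olc_target [set: 'I_N])) // => /addIr.
Qed.

Lemma full_arms_mean (f : 'I_n -> bool -> R) :
  \sum_d q d * \sum_i f (sv i) (d.2 i) =
  \sum_s (((cnt sv [set: 'I_N] s)%:R - olc_target [set: 'I_N] s) * f s false
    + olc_target [set: 'I_N] s * f s true).
Proof.
rewrite full_sum /=.
rewrite (eq_bigr (fun a => \sum_s ((w a * (cnt sv [set: 'I_N] s)%:R
   - w a * (cnt_act sv a [set: 'I_N] s)%:R) * f s false
   + (w a * (cnt_act sv a [set: 'I_N] s)%:R) * f s true))); last first.
  move=> a _; have -> : \sum_i f (sv i) (a i) = \sum_(i in [set: 'I_N]) f (sv i) (a i).
    by apply: eq_bigl => i; rewrite inE.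
  rewrite sum_arms mulr_sumr; apply: eq_bigr => s _; ring.
rewrite exchange_big /=; apply: eq_bigr => s _.
rewrite big_split /= -!mulr_suml sumrB -mulr_suml full_mass mul1r !full_mean //.
Qed.
End FullSet.
End OneStep.

(** * The Markov chain *)

Section Product.
Context {R : realType} {n N : nat} (p : 'I_N -> 'I_n -> R).
Hypothesis p1 : forall i, \sum_s p i s = 1.

Lemma prod_mass : \sum_(f : {ffun 'I_N -> 'I_n}) \prod_i p i (f i) = 1.
Proof.
by rewrite -(bigA_distr_bigA (fun i s => p i s)) big1.
Qed.

Lemma prod_marginal i0 s :
  \sum_(f : {ffun 'I_N -> 'I_n}) (\prod_i p i (f i)) * (f i0 == s)%:R = p i0 s.
Proof.
rewrite (eq_bigr (fun f : {ffun 'I_N -> 'I_n} =>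
   \prod_i (p i (f i) * (if i == i0 then (f i == s)%:R else 1)))); last first.
  move=> f _; rewrite big_split /=; congr (_ * _).
  by rewrite (bigD1 i0) //= eqxx big1 ?mulr1 // => i /negbTE ->.
rewrite -(bigA_distr_bigA (fun i s' => p i s' * (if i == i0 then (s' == s)%:R else 1))) /=.
rewrite (bigD1 i0) //= [X in _ * X]big1 ?mulr1; last first.
  by move=> i /negbTE ->; under eq_bigr do rewrite mulr1; rewrite p1.
rewrite eqxx (bigD1 s) //= eqxx mulr1 big1 ?addr0 // => s' /negbTE ->.
by rewrite mulr0.
Qed.
End Product.

Section Chain.
Context {R : realType} {n : nat}.
Variables (P : 'I_n -> bool -> 'I_n -> R) (alpha : R).
Variables (y : 'I_n -> bool -> R) (st : 'I_n).
Hypotheses (Pok : kernel_ok P).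
Variables (N : nat) (eta efe erd : R) (q : rule (R:=R) (n:=n) N).
Hypothesis pol : two_set_policy P alpha y st eta efe erd q.
Variable (S0 : svec (n:=n) N).
Implicit Types (sg : cstate (n:=n) N) (d : dec N) (sv : svec (n:=n) N).
Local Notation dist := (dist P q S0).

Let P0 s a s' : 0 <= P s a s'. Proof. by case: Pok. Qed.
Let P1 s a : \sum_s' P s a s' = 1. Proof. by case: Pok. Qed.

Definition trans (sg : cstate (n:=n) N) (d : dec N) (sv' : svec (n:=n) N) : R :=
  \prod_i P (sg.1.1 i) (d.2 i) (sv' i).

Lemma trans_ge0 sg d sv' : 0 <= trans sg d sv'.
Proof. by apply: prodr_ge0. Qed.

Lemma trans_mass sg d : \sum_sv' trans sg d sv' = 1.
Proof. by apply: (prod_mass (p := fun i s => P (sg.1.1 i) (d.2 i) s)). Qed.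

Lemma trans_mass1 sg d : \sum_sv' trans sg d sv' * 1 = 1.
Proof. by rewrite -mulr_suml trans_mass mulr1. Qed.

(* One step of the chain, keeping only the transitions accepted by G; for the trivial
   filter this is step. *)
Definition gstep (G : cstate (n:=n) N -> dec N -> svec (n:=n) N -> bool)
    (mu : cstate (n:=n) N -> R) : cstate (n:=n) N -> R :=
  fun sg' => \sum_sg mu sg * \sum_(a : avec N) q sg (sg'.1.2, sg'.2, a) *
    (if G sg (sg'.1.2, sg'.2, a) sg'.1.1 then trans sg (sg'.1.2, sg'.2, a) sg'.1.1 else 0).

Lemma step_gstep mu : step P q mu =1 gstep (fun _ _ _ => true) mu.
Proof. by case=> [[sv' A] Q]. Qed.

(** Duality: a step of the measure becomes a conditional expectation of the test function, split
    into decision and transition. *)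
Lemma gstep_sum G mu (h : cstate (n:=n) N -> R) :
  \sum_sg' gstep G mu sg' * h sg' =
  \sum_sg mu sg * \sum_d q sg d * \sum_sv'
     (if G sg d sv' then trans sg d sv' else 0) * h (sv', d.1.1, d.1.2).
Proof.
rewrite /gstep; under eq_bigr do rewrite mulr_suml.
rewrite exchange_big /=; apply: eq_bigr => sg _.
under eq_bigr do rewrite -mulrA; rewrite -mulr_sumr; congr (_ * _).
rewrite [LHS](eq_bigr (fun sg' => \sum_(a : avec N) q sg (sg'.1.2, sg'.2, a) *
   (if G sg (sg'.1.2, sg'.2, a) sg'.1.1 then trans sg (sg'.1.2, sg'.2, a) sg'.1.1 else 0)
   * h sg')); last by move=> sg' _; rewrite mulr_suml.
rewrite [RHS](eq_bigr (fun d => \sum_sv' q sg d *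
   ((if G sg d sv' then trans sg d sv' else 0) * h (sv', d.1.1, d.1.2)))); last first.
  by move=> d _; rewrite mulr_sumr.
rewrite [RHS]exchange_big /= [RHS](eq_bigr (fun sv' => \sum_A \sum_Q \sum_a
   q sg (A, Q, a) * (if G sg (A, Q, a) sv' then trans sg (A, Q, a) sv' else 0) * h (sv', A, Q))).
  rewrite [RHS]pair_bigA /= [RHS]pair_bigA /=.
  by apply: eq_bigr => -[[sv' A] Q] _.
move=> sv' _; rewrite [RHS]pair_bigA /= [RHS]pair_bigA /=.
by apply: eq_bigr => -[[A Q] a] _; rewrite mulrA.
Qed.

(** The policy is constrained only where [dist] is positive, so only there is [q sg] known to be a
    probability. *)
Definition reach sg := exists t, 0 < dist t sg.

Lemma reach_valid sg : reach sg -> valid_at P alpha y st eta efe erd sg (q sg).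
Proof. by case=> t h; exact: pol h. Qed.

Lemma reach_q sg : reach sg -> (forall d, 0 <= q sg d) /\ \sum_d q sg d = 1.
Proof. by move=> /reach_valid; case: sg => [[sv A] Q] [h1 h2 _ _]. Qed.

Lemma gstep_ge0 G mu : (forall sg, 0 <= mu sg) -> (forall sg, 0 < mu sg -> reach sg) ->
  forall sg, 0 <= gstep G mu sg.
Proof.
move=> mu0 mur sg; apply: sumr_ge0 => sg1 _.
have [->|e] := eqVneq (mu sg1) 0; first by rewrite mul0r.
have /mur/reach_q[q0 _] : 0 < mu sg1 by rewrite lt_neqAle eq_sym e mu0.
rewrite mulr_ge0 // sumr_ge0 // => a _; rewrite mulr_ge0 //.
by case: ifP => // _; exact: trans_ge0.
Qed.

Lemma dist_ge0 t sg : 0 <= dist t sg.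
Proof.
elim: t sg => [|t IH] sg; first by rewrite /Defs.dist /=; case: eqP.
rewrite /Defs.dist iterS step_gstep; apply: gstep_ge0 => // sg1 h.
by exists t.
Qed.

Lemma dist_neq0 t sg : dist t sg != 0 -> reach sg.
Proof. by move=> h; exists t; rewrite lt_neqAle eq_sym h dist_ge0. Qed.

Lemma dist_next t (h : cstate (n:=n) N -> R) :
  \sum_sg dist t.+1 sg * h sg =
  \sum_sg dist t sg * \sum_d q sg d * \sum_sv' trans sg d sv' * h (sv', d.1.1, d.1.2).
Proof. by rewrite -(gstep_sum (fun _ _ _ => true)); apply: eq_bigr => sg _; rewrite -step_gstep. Qed.

Lemma dist_congr t (h1 h2 : cstate (n:=n) N -> R) : (forall sg, reach sg -> h1 sg = h2 sg) ->
  \sum_sg dist t sg * h1 sg = \sum_sg dist t sg * h2 sg.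
Proof.
move=> h; apply: eq_bigr => sg _.
have [->|/dist_neq0 r] := eqVneq (dist t sg) 0; first by rewrite !mul0r.
by rewrite h.
Qed.

Lemma dist_mass t : \sum_sg dist t sg = 1.
Proof.
elim: t => [|t IH].
  rewrite (bigD1 (S0, finset.set0, finset.set0)) //= eqxx big1 ?addr0 // => sg.
  by move=> /negbTE; rewrite /Defs.dist /= => ->.
transitivity (\sum_sg dist t.+1 sg * 1); first by rewrite -mulr_suml mulr1.
rewrite (dist_next t (fun=> 1)).
rewrite -[RHS]IH [RHS](eq_bigr (fun sg => dist t sg * 1)) => [|sg _]; last by rewrite mulr1.
apply: dist_congr => sg /reach_q[_ q1].
rewrite (eq_bigr (q sg)) // => d _.
by rewrite trans_mass1 mulr1.
Qed.

Section Good.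
Variable eps : R.
Hypothesis eps01 : 0 < eps <= 1.

Definition quiet (sg : cstate (n:=n) N) (d : dec N) (sv' : svec (n:=n) N) : bool :=
  [forall s, `|noise P sg.1.1 sv' d.2 d.1.1 s| <= eps * N%:R] &&
  [forall s, `|noise P sg.1.1 sv' d.2 d.1.2 s| <= eps * N%:R].

(** The factor 4 n counts two sets, n states and the two tails of the Chernoff bound. *)
Definition loud_bound : R := 4 * n%:R * expR (- (eps ^+ 2 / 8) * N%:R).

Lemma loud_mass sg d :
  \sum_(sv' | ~~ quiet sg d sv') trans sg d sv' <= loud_bound.
Proof.
have one D : \sum_sv' \sum_(s | eps * N%:R < `|noise P sg.1.1 sv' d.2 D s|) trans sg d sv'
    <= 2 * n%:R * expR (- (eps ^+ 2 / 8) * N%:R).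
  rewrite (exchange_big_dep xpredT) //=.
  apply: (@le_trans _ _ (\sum_(s < n) 2 * expR (- (eps ^+ 2 / 8) * N%:R))).
    apply: ler_sum => s _.
    exact: (chernoff (p := fun i s' => P (sg.1.1 i) (d.2 i) s') D s _ _ eps01).
  by rewrite sumr_const card_ord -[leLHS]mulr_natl mulrA [n%:R * 2]mulrC.
apply: (@le_trans _ _ (\sum_sv' \sum_(s | eps * N%:R < `|noise P sg.1.1 sv' d.2 d.1.1 s|) trans sg d sv'
  + \sum_sv' \sum_(s | eps * N%:R < `|noise P sg.1.1 sv' d.2 d.1.2 s|) trans sg d sv')); last first.
  by have := one d.1.1; have := one d.1.2; rewrite /loud_bound; lra.
rewrite -big_split /= big_mkcond ler_sum // => sv' _.
have t0 := trans_ge0 sg d sv'.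
have s0 D : 0 <= \sum_(s | eps * N%:R < `|noise P sg.1.1 sv' d.2 D s|) trans sg d sv'.
  exact: sumr_ge0.
have s1 D s : ~~ (`|noise P sg.1.1 sv' d.2 D s| <= eps * N%:R) ->
    trans sg d sv' <= \sum_(s | eps * N%:R < `|noise P sg.1.1 sv' d.2 D s|) trans sg d sv'.
  by rewrite -ltNge => h; rewrite (bigD1 s) //= lerDl sumr_ge0.
case: ifP => // [|_]; last by rewrite addr_ge0.
rewrite negb_and => /orP[|] /fintype.forallPn[s /s1 h].
  by apply: le_trans h _; rewrite lerDl.
by apply: le_trans h _; rewrite lerDr.
Qed.

(* Mass of the trajectories whose steps t0, ..., t0 + k - 1 are all quiet. *)
Fixpoint qdist t0 k : cstate (n:=n) N -> R :=
  if k is k'.+1 then gstep quiet (qdist t0 k') else dist t0.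

Lemma qdist_bounds t0 k sg : 0 <= qdist t0 k sg <= dist (t0 + k) sg.
Proof.
elim: k sg => [|k IH] sg /=; first by rewrite addn0 dist_ge0 lexx.
have r1 sg1 : 0 < qdist t0 k sg1 -> reach sg1.
  by move=> h; exists (t0 + k)%N; case/andP: (IH sg1) => _; exact: lt_le_trans.
rewrite gstep_ge0 //=; last by move=> sg1; case/andP: (IH sg1).
rewrite addnS /Defs.dist iterS step_gstep -/(Defs.dist P q S0 (t0 + k)).
apply: ler_sum => sg1 _; case/andP: (IH sg1) => h0 h1.
have [e|e] := eqVneq (dist (t0 + k) sg1) 0.
  have -> : qdist t0 k sg1 = 0 by apply/eqP; rewrite eq_le h0 -e h1.
  by rewrite e !mul0r.
have [q0 _] := reach_q (dist_neq0 e).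
apply: ler_pM => //.
  by apply: sumr_ge0 => a _; rewrite mulr_ge0 //; case: ifP => // _; exact: trans_ge0.
apply: ler_sum => a _; rewrite ler_wpM2l //.
by case: ifP => // _; exact: trans_ge0.
Qed.

Lemma qdist_mass t0 k : 1 - k%:R * loud_bound <= \sum_sg qdist t0 k sg.
Proof.
elim: k => [|k IH]; first by rewrite mul0r subr0 dist_mass.
have lb0 : 0 <= loud_bound by rewrite !mulr_ge0 ?expR_ge0.
have -> : \sum_sg qdist t0 k.+1 sg = \sum_sg qdist t0 k.+1 sg * 1.
  by apply: eq_bigr => sg _; rewrite mulr1.
rewrite (gstep_sum quiet (qdist t0 k)).
apply: (@le_trans _ _ (\sum_sg qdist t0 k sg * (1 - loud_bound))).
  rewrite -mulr_suml; have : \sum_sg qdist t0 k sg <= 1.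
    rewrite -(dist_mass (t0 + k)); apply: ler_sum => sg _.
    by case/andP: (qdist_bounds t0 k sg).
  by rewrite -natr1; move: IH lb0; nra.
apply: ler_sum => sg _; case/andP: (qdist_bounds t0 k sg) => h0 h1.
have [e|e] := eqVneq (qdist t0 k sg) 0; first by rewrite e !mul0r.
have [q0 q1] : (forall d, 0 <= q sg d) /\ \sum_d q sg d = 1.
  apply: reach_q; exists (t0 + k)%N; apply: lt_le_trans h1.
  by rewrite lt_neqAle eq_sym e h0.
rewrite ler_wpM2l // -[leLHS]mul1r -[X in X * _ <= _]q1 mulr_suml; apply: ler_sum => d _.
rewrite ler_wpM2l // -mulr_suml mulr1.
rewrite -big_mkcond /= -(trans_mass sg d) (bigID (quiet sg d)) /=.
by have := loud_mass sg d; lra.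
Qed.

(** Positive mass of the filtered chain yields an actual trajectory, to which the deterministic
    analysis applies. *)
Lemma qdist_path t0 k sg : 0 < qdist t0 k sg ->
  exists (h : nat -> cstate (n:=n) N) (av : nat -> avec N), h k = sg /\
  forall j, (j < k)%N -> [/\ reach (h j),
     0 < q (h j) ((h j.+1).1.2, (h j.+1).2, av j) &
     quiet (h j) ((h j.+1).1.2, (h j.+1).2, av j) (h j.+1).1.1].
Proof.
elim: k sg => [|k IH] sg; first by exists (fun=> sg), (fun=> [ffun=> false]).
move=> /= hpos.
have [sg1 hs1] : exists sg1, 0 < qdist t0 k sg1 *
   \sum_(a : avec N) q sg1 (sg.1.2, sg.2, a) *
   (if quiet sg1 (sg.1.2, sg.2, a) sg.1.1 then trans sg1 (sg.1.2, sg.2, a) sg.1.1 else 0).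
  apply: contrapT => hno; move: hpos; rewrite /gstep ltNge => /negP; apply.
  apply: sumr_le0 => sg1 _; rewrite leNgt; apply/negP => h; apply: hno.
  by exists sg1.
case/andP: (qdist_bounds t0 k sg1) => h0 h1.
have hq : 0 < qdist t0 k sg1.
  rewrite lt_neqAle h0 andbT eq_sym; apply/eqP => e; move: hs1.
  by rewrite e mul0r ltxx.
have r1 : reach sg1 by exists (t0 + k)%N; exact: lt_le_trans h1.
have [q0 _] := reach_q r1.
have [a ha] : exists a : avec N, 0 < q sg1 (sg.1.2, sg.2, a) *
   (if quiet sg1 (sg.1.2, sg.2, a) sg.1.1 then trans sg1 (sg.1.2, sg.2, a) sg.1.1 else 0).
  apply: contrapT => hno; move: hs1; rewrite pmulr_rgt0 // ltNge => /negP; apply.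
  apply: sumr_le0 => a _; rewrite leNgt; apply/negP => h; apply: hno.
  by exists a.
have ha0 : 0 < q sg1 (sg.1.2, sg.2, a).
  rewrite lt_neqAle q0 andbT eq_sym; apply/eqP => e; move: ha.
  by rewrite e mul0r ltxx.
have hqu : quiet sg1 (sg.1.2, sg.2, a) sg.1.1.
  by move: ha; case: ifP => //; rewrite mulr0 ltxx.
have [h [av [hk hh]]] := IH _ hq.
exists (fun j => if (j <= k)%N then h j else sg), (fun j => if (j < k)%N then av j else a).
split; first by rewrite ltnn.
move=> j; rewrite ltnS leq_eqVlt => /orP[/eqP ->|jk].
  by rewrite eqxx ltnn hk.
by rewrite jk orbT; exact: hh.
Qed.
End Good.

Section ChainCesaro.
Local Open Scope classical_set_scope.
Local Open Scope ring_scope.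
Variable (rew : cstate (n:=n) N -> R).

Lemma dist_cesaro :
  cvgn (fun T : nat => T%:R^-1 * \sum_(t < T) \sum_sg dist t sg * rew sg).
Proof.
pose K sg sg' := \sum_(a : avec N) q sg (sg'.1.2, sg'.2, a) * trans sg (sg'.1.2, sg'.2, a) sg'.1.1.
(* Identity rows at the other chain states make M stochastic everywhere; [dist] never charges those
   states. *)
pose M : 'M[R]_#|{: cstate (n:=n) N}| := \matrix_(i, j)
  (if `[< reach (enum_val i) >] then K (enum_val i) (enum_val j) else (i == j)%:R).
pose d0 : 'rV[R]_#|{: cstate (n:=n) N}| := \row_i dist 0 (enum_val i).
pose g : 'cV[R]_#|{: cstate (n:=n) N}| := \col_i rew (enum_val i).
have Ksum sg : reach sg -> \sum_sg' K sg sg' = 1.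
  move=> r; have [q0 q1] := reach_q r.
  have := gstep_sum (fun _ _ _ => true) (fun sg1 => (sg1 == sg)%:R) (fun=> 1).
  rewrite [RHS](bigD1 sg) //= [X in _ = _ + X -> _]big1 ?addr0; last first.
    by move=> sg1 /negbTE ->; rewrite mul0r.
  rewrite eqxx mul1r => h.
  transitivity (\sum_sg' gstep (fun _ _ _ => true) (fun sg1 => (sg1 == sg)%:R) sg' * 1).
    apply: eq_bigr => sg' _; rewrite mulr1 /gstep (bigD1 sg) //= eqxx mul1r [X in _ = _ + X]big1 ?addr0 //.
    by move=> sg1 /negbTE ->; rewrite mul0r.
  rewrite h -[RHS]q1; apply: eq_bigr => d _.
  by rewrite trans_mass1 mulr1.
have M0 i j : 0 <= M i j.
  rewrite mxE; case: asboolP => [r|_] //; have [q0 _] := reach_q r.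
  by apply: sumr_ge0 => a _; rewrite mulr_ge0 // trans_ge0.
have M1 i : \sum_j M i j = 1.
  under eq_bigr do rewrite mxE; case: asboolP => [r|_].
    by rewrite -[RHS](Ksum _ r) [RHS]big_enum_val.
  rewrite (bigD1 i) //= eqxx big1 ?addr0 // => j; rewrite eq_sym => /negbTE -> //.
have dE t i : (d0 *m M ^+ t) 0 i = dist t (enum_val i).
  elim: t i => [|t IH] i; first by rewrite expr0 mulmx1 mxE.
  rewrite exprSr -mulmxE mulmxA mxE /Defs.dist iterS step_gstep /gstep.
  rewrite [RHS]big_enum_val; apply: eq_bigr => j _; rewrite IH -/(Defs.dist P q S0 t).
  have [->|e] := eqVneq (dist t (enum_val j)) 0; first by rewrite !mul0r.
  by congr (_ * _); rewrite mxE; case: asboolP => // -[]; exact: dist_neq0 e.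
have -> : (fun T : nat => T%:R^-1 * \sum_(t < T) \sum_sg dist t sg * rew sg) =
    (fun T : nat => T%:R^-1 * \sum_(t < T) (d0 *m M ^+ t *m g) 0 0); last exact: cesaro_stoch.
apply/funext => T; congr (_ * _); apply: eq_bigr => t _.
rewrite [LHS]big_enum_val mxE; apply: eq_bigr => i _.
by rewrite dE mxE.
Qed.
End ChainCesaro.
End Chain.

(** * The optimality gap *)

Section Gap.
Context {R : realType} {n : nat}.
Variables (P : 'I_n -> bool -> 'I_n -> R) (r : 'I_n -> bool -> R) (alpha : R).
Variables (y : 'I_n -> bool -> R) (st : 'I_n).
Hypotheses (Pok : kernel_ok P) (yfeas : lp_feasible P alpha y)
  (A2 : assumption2 y st).
Local Notation nm := (Unorm P alpha y st).
Local Notation F := (Phi P alpha y st).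
Variables (rho cu : R).
Hypotheses (nmD : forall v w, nm (v + w) <= nm v + nm w) (rho01 : 0 <= rho < 1)
  (cu0 : 0 < cu) (nmF : forall v, nm (v *m F) <= rho * nm v)
  (nm_l1 : forall v, nm v <= cu * l1 v) (le_nm : forall (v : 'rV[R]_n) s, `|v 0 s| <= nm v).

(* Under OLC on all arms the activation in st is dictated by the budget; eliminating it
   makes the mean reward affine in the occupation vector, with this slope. *)
Definition rew_slope (s : 'I_n) : R :=
  if s == st then r st false
  else pibar y false s * r s false + pibar y true s * r s true
       - pibar y true s * (r st true - r st false).

(** This and [rew_bound] are crude bounds, from |dv| <= 2 in each entry, for the failure of the
    exact drift and reward identities where the slack of [N] is negative. *)
Definition flow_bound : R := 2 + 2 * \sum_i \sum_j `|F i j|.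
Definition rew_bound : R := (\sum_s \sum_(a : bool) `|r s a|) + `|lp_obj r y| + 2 * \sum_s `|rew_slope s|.
Definition gap_const : R :=
  rew_bound + (\sum_s `|rew_slope s|) * (cu * (4 + n%:R * flow_bound) / (1 - rho)).

Variables (N : nat) (eta efe erd : R) (q : rule (R:=R) (n:=n) N).
Hypotheses (N0 : (0 < N)%N) (pol : two_set_policy P alpha y st eta efe erd q)
  (aN : exists k : nat, alpha * N%:R = k%:R).
Variable (S0 : svec (n:=n) N).
Local Notation dist := (dist P q S0).
Local Notation T := [set: 'I_N].
Local Notation sl sg := (slack P alpha y st eta efe sg.1.1 [set: 'I_N]).

Let P1 s a : \sum_s' P s a s' = 1. Proof. by case: Pok. Qed.
Let NR : 0 < N%:R :> R. Proof. by rewrite ltr0n. Qed.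
Let mu0 := mustar_ge0 yfeas.
Let mu1 := mustar_sum yfeas.

Definition rew (sg : cstate (n:=n) N) : R :=
  \sum_d q sg d * (N%:R^-1 * \sum_i r (sg.1.1 i) (d.2 i)).

(** When dv = 0 the occupation is mustar and the mean activated mass in each s is [y s true], so the
    constant term is the value of the LP. *)
Lemma rew_full sg : reach P q S0 sg -> 0 <= sl sg ->
  rew sg = lp_obj r y + \sum_s dv y sg.1.1 T 0 s * rew_slope s.
Proof.
move=> /(reach_valid pol); case: sg => [[sv A] Q] val full.
have e1 : rew (sv, A, Q) = N%:R^-1 * \sum_d q (sv, A, Q) d * \sum_i r (sv i) (d.2 i).
  by rewrite mulr_sumr; apply: eq_bigr => d _; rewrite mulrCA.
rewrite e1 (full_arms_mean yfeas A2 val full aN).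
pose x s : R := (cnt sv T s)%:R / N%:R.
pose t : R := alpha - \sum_(s | s != st) pibar y true s * x s.
have tst : olc_target alpha y st sv T st / N%:R = t.
  rewrite /olc_target eqxx cardsT card_ord mulrBl mulfK ?gt_eqF // mulr_suml.
  by congr (_ - _); apply: eq_bigr => s _; rewrite mulrA.
have toth s : s != st -> olc_target alpha y st sv T s / N%:R = pibar y true s * x s.
  by move=> ss; rewrite /olc_target (negbTE ss) mulrA.
have pf s : pibar y false s = 1 - pibar y true s by rewrite -(pibar_mass y s) addrK.
have dvE s : dv y sv T 0 s = x s - (y s false + y s true).
  by rewrite /dv mDT // scale1r !mxE.
rewrite /lp_obj mulr_sumr [LHS](bigD1 st) //= [X in _ = X + _](bigD1 st) //= [X in _ = _ + X](bigD1 st) //=.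
have aE : alpha = y st true + \sum_(s | s != st) y s true.
  by case: yfeas => _ <- _ _; rewrite (bigD1 st).
have -> : N%:R^-1 * (((cnt sv T st)%:R - olc_target alpha y st sv T st) * r st false +
   olc_target alpha y st sv T st * r st true) = (x st - t) * r st false + t * r st true.
  by rewrite -tst /x; field; rewrite gt_eqF.
have -> : \sum_(i < n | i != st) N%:R^-1 * (((cnt sv T i)%:R - olc_target alpha y st sv T i) * r i false +
   olc_target alpha y st sv T i * r i true) =
   \sum_(i < n | i != st) x i * (pibar y false i * r i false + pibar y true i * r i true).
  apply: eq_bigr => s ss; rewrite pf.
  transitivity ((x s - olc_target alpha y st sv T s / N%:R) * r s false +
     olc_target alpha y st sv T s / N%:R * r s true); first by rewrite /x; ring.
  by rewrite toth //; ring.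
have -> : \sum_(i < n | i != st) dv y sv T 0 i * rew_slope i =
   \sum_(i < n | i != st) x i * (pibar y false i * r i false + pibar y true i * r i true)
   - \sum_(i < n | i != st) \sum_(a : bool) r i a * y i a
   - (\sum_(s | s != st) pibar y true s * x s - \sum_(s | s != st) y s true) * (r st true - r st false).
  rewrite mulrBl !mulr_suml -!sumrB; apply: eq_bigr => s ss.
  have hf := pibar_mustar yfeas false s; have ht := pibar_mustar yfeas true s.
  rewrite mxE in hf ht; rewrite dvE /rew_slope (negbTE ss) big_bool /=.
  set mu := y s false + y s true in hf ht *; rewrite -hf -ht; ring.
rewrite dvE /rew_slope eqxx big_bool /= /t aE; ring.
Qed.

Lemma expected_dv sg d s : \sum_sv' trans P sg d sv' * dv y sv' T 0 s =
  (\sum_i P (sg.1.1 i) (d.2 i) s) / N%:R - mustar y 0 s.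
Proof.
have e sv' : dv y sv' T 0 s = (\sum_i (sv' i == s)%:R) / N%:R - mustar y 0 s.
  have -> : \sum_i (sv' i == s)%:R = (cnt sv' T s)%:R :> R.
    by rewrite cntE; apply: eq_bigl => i; rewrite inE.
  by rewrite /dv mDT // scale1r !mxE.
rewrite (eq_bigr (fun sv' => (\sum_i trans P sg d sv' * (sv' i == s)%:R) / N%:R
   - trans P sg d sv' * mustar y 0 s)); last first.
  by move=> sv' _; rewrite e mulrBr mulrA mulr_sumr.
rewrite sumrB -!mulr_suml (trans_mass Pok) mul1r; congr (_ / _ - _).
rewrite exchange_big /=; apply: eq_bigr => i _.
exact: (prod_marginal (p := fun i s' => P (sg.1.1 i) (d.2 i) s')).
Qed.

Definition next_dv (sg : cstate (n:=n) N) (s : 'I_n) : R :=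
  \sum_d q sg d * \sum_sv' trans P sg d sv' * dv y sv' T 0 s.

(** No term of order 1/N appears: the activation counts have mean exactly [olc_target], and the mean
    transition is linear in them. *)
Lemma next_full sg s : reach P q S0 sg -> 0 <= sl sg ->
  next_dv sg s = (dv y sg.1.1 T *m F) 0 s.
Proof.
move=> rs; have [q0 q1] := reach_q pol rs; move: rs => /(reach_valid pol).
case: sg q0 q1 => [[sv A] Q] /= q0 q1 val full.
rewrite -(flow_olc_target st yfeas) // mDT // scale1r.
have -> (u v : 'rV[R]_n) : (u - v) 0 s = u 0 s - v 0 s by rewrite !mxE.
rewrite /next_dv (eq_bigr (fun d => q (sv, A, Q) d * (\sum_i P (sv i) (d.2 i) s) / N%:R
   - q (sv, A, Q) d * mustar y 0 s)); last by move=> d _; rewrite expected_dv mulrBr mulrA.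
rewrite sumrB -!mulr_suml q1 mul1r; congr (_ - _).
rewrite (full_arms_mean yfeas A2 val full aN (fun s1 b => P s1 b s)) mulr_suml mxE.
by apply: eq_bigr => s1 _; rewrite mxE; ring.
Qed.

Lemma dv_le2 sv s : `|dv y sv T 0 s| <= 2.
Proof.
apply: le_trans (le_l1 _ _) _; apply: le_trans (l1_dv mu0 mu1 _ _) _.
by rewrite mDT // mulr1.
Qed.

Lemma mean_le sg (f : dec N -> R) b : reach P q S0 sg -> (forall d, `|f d| <= b) ->
  `|\sum_d q sg d * f d| <= b.
Proof.
move=> /(reach_q pol)[q0 q1] fb; apply: le_trans (ler_norm_sum _ _ _) _.
rewrite -[leRHS]mul1r -[X in _ <= X * _]q1 mulr_suml; apply: ler_sum => d _.
by rewrite normrM ger0_norm // ler_wpM2l.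
Qed.

Lemma next_dv_le2 sg s : reach P q S0 sg -> `|next_dv sg s| <= 2.
Proof.
move=> rs; apply: mean_le => // d; apply: le_trans (ler_norm_sum _ _ _) _.
rewrite -[leRHS]mul1r -[X in _ <= X * _](trans_mass Pok sg d) mulr_suml; apply: ler_sum => sv' _.
have t0 := trans_ge0 Pok sg d sv'.
by rewrite normrM (ger0_norm t0); apply: ler_wpM2l => //; exact: dv_le2.
Qed.

Lemma rew_le sg : reach P q S0 sg -> `|rew sg| <= \sum_s \sum_(a : bool) `|r s a|.
Proof.
move=> rs; apply: mean_le => // d.
rewrite normrM normfV (ger0_norm (ltW NR)) mulrC ler_pdivrMr //.
apply: le_trans (ler_norm_sum _ _ _) _.
rewrite -[N in leRHS]card_ord mulr_natr -sumr_const; apply: ler_sum => i _.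
rewrite (bigD1 (sg.1.1 i)) //= (bigD1 (d.2 i)) //= -addrA lerDl addr_ge0 // sumr_ge0 // => *.
exact: sumr_ge0.
Qed.

(** The mean deviation of all arms at time t; [p t] is the probability that the slack of [N] is
    negative. *)
Let f t : 'rV[R]_n := \row_s \sum_sg dist t sg * dv y sg.1.1 T 0 s.
Let p t : R := \sum_sg dist t sg * (sl sg < 0)%R%:R.

Lemma bad_mass_ge0 t : 0 <= p t.
Proof. by apply: sumr_ge0 => sg _; rewrite mulr_ge0 // (dist_ge0 Pok pol). Qed.

Lemma dist_bad_bound t (h : cstate (n:=n) N -> R) b : 0 <= b ->
  (forall sg, reach P q S0 sg -> 0 <= sl sg -> h sg = 0) ->
  (forall sg, reach P q S0 sg -> `|h sg| <= b) ->
  `|\sum_sg dist t sg * h sg| <= b * p t.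
Proof.
move=> b0 h0 hb; apply: le_trans (ler_norm_sum _ _ _) _.
rewrite /p mulr_sumr; apply: ler_sum => sg _.
have d0 := dist_ge0 Pok pol S0 t sg.
have [->|/(dist_neq0 Pok pol) rs] := eqVneq (dist t sg) 0.
  by rewrite !mul0r normr0 mulr0.
rewrite normrM (ger0_norm d0) mulrCA ler_wpM2l //.
have [hs|hs] := ltP (sl sg) 0; first by rewrite mulr1 hb.
by rewrite h0 // normr0 mulr0.
Qed.

Let er t := f t.+1 - f t *m F.

Lemma drift_error_le t : l1 (er t) <= n%:R * (flow_bound * p t).
Proof.
apply: l1_le_const => s.
have -> : er t 0 s = \sum_sg dist t sg * (next_dv sg s - (dv y sg.1.1 T *m F) 0 s).
  have -> : er t 0 s = f t.+1 0 s - (f t *m F) 0 s by rewrite !mxE.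
  rewrite mxE (dist_next _ _ _ _ (fun sg => dv y sg.1.1 T 0 s)).
  rewrite [RHS](eq_bigr (fun sg => dist t sg * next_dv sg s - dist t sg * (dv y sg.1.1 T *m F) 0 s)).
    rewrite sumrB; congr (_ - _); rewrite mxE.
    transitivity (\sum_j \sum_sg dist t sg * (dv y sg.1.1 T 0 j * F j s)).
      by apply: eq_bigr => j _; rewrite mxE mulr_suml; apply: eq_bigr => sg _; rewrite mulrA.
    by rewrite exchange_big /=; apply: eq_bigr => sg _; rewrite mxE mulr_sumr.
  by move=> sg _; rewrite mulrBr.
have fb0 : 0 <= flow_bound by rewrite addr_ge0 // mulr_ge0 // sumr_ge0 // => i _; exact: sumr_ge0.
apply: dist_bad_bound => // [sg rs full|sg rs]; first by rewrite next_full // subrr.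
apply: le_trans (ler_normB _ _) _; apply: lerD; first exact: next_dv_le2.
rewrite mxE; apply: le_trans (ler_norm_sum _ _ _) _; rewrite mulr_sumr ler_sum // => j _.
rewrite normrM; apply: ler_pM => //; first exact: dv_le2.
by rewrite (bigD1 s) //= lerDl sumr_ge0.
Qed.

Lemma mean_dv_le2 t : l1 (f t) <= 2.
Proof.
rewrite /l1; apply: (@le_trans _ _ (\sum_s \sum_sg dist t sg * `|dv y sg.1.1 T 0 s|)).
  apply: ler_sum => s _; rewrite mxE; apply: le_trans (ler_norm_sum _ _ _) _.
  by apply: ler_sum => sg _; rewrite normrM ger0_norm // (dist_ge0 Pok pol).
rewrite exchange_big /= -[leRHS]mul1r -[X in _ <= X * _](dist_mass Pok pol S0 t) mulr_suml.
apply: ler_sum => sg _; rewrite -mulr_sumr ler_wpM2l ?(dist_ge0 Pok pol) //.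
by apply: le_trans (l1_dv mu0 mu1 _ _) _; rewrite mDT // mulr1.
Qed.

(* Summing f (t + 1) = f t *m Phi + er t over t bounds the sum S through
   S = S *m Phi + O(1 + \sum_t p t) and the contraction of the norm. *)
Lemma mean_dv_sum_le m : nm (\sum_(t < m) f t)
  <= cu * (4 + n%:R * flow_bound * \sum_(t < m) p t) / (1 - rho).
Proof.
have r1 : 0 < 1 - rho by move: rho01; lra.
rewrite ler_pdivlMr //; set S := \sum_(t < m) f t.
have SE : S = S *m F + (f 0 - f m + \sum_(t < m) er t).
  rewrite /S mulmx_suml; elim: (m) => [|k IH]; first by rewrite !big_ord0 subrr !addr0.
  rewrite !big_ord_recr /= {1}IH /er; apply/rowP => s; rewrite !mxE; ring.
have h1 : nm S <= rho * nm S + cu * l1 (f 0 - f m + \sum_(t < m) er t).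
  by rewrite {1}SE; apply: le_trans (nmD _ _) _; apply: lerD.
have h2 : l1 (f 0 - f m + \sum_(t < m) er t) <= 4 + n%:R * flow_bound * \sum_(t < m) p t.
  apply: le_trans (l1D _ _) _; apply: lerD.
    by apply: le_trans (l1D _ _) _; rewrite l1N; have := mean_dv_le2 0; have := mean_dv_le2 m; lra.
  apply: le_trans (l1_sum _ _) _; rewrite mulr_sumr ler_sum // => t _.
  by rewrite -mulrA drift_error_le.
have h3 : cu * l1 (f 0 - f m + \sum_(t < m) er t) <=
  cu * (4 + n%:R * flow_bound * \sum_(t < m) p t) by rewrite ler_pM2l.
by lra.
Qed.

Lemma exp_rewE t : exp_rew P r q S0 t = \sum_sg dist t sg * rew sg.
Proof. by []. Qed.

(** The deviation enters the reward linearly, so what counts is the norm of the sum of the [f t],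
    bounded by [mean_dv_sum_le] independently of m apart from the sum of the [p t]. *)
Lemma sum_rew_ge m :
  m%:R * lp_obj r y - gap_const * (1 + \sum_(t < m) p t)
    <= \sum_(t < m) exp_rew P r q S0 t.
Proof.
set Sp := \sum_(t < m) p t; have Sp0 : 0 <= Sp by apply: sumr_ge0 => t _; exact: bad_mass_ge0.
have r1 : 0 < 1 - rho by move: rho01; lra.
have G0 : 0 <= \sum_s `|rew_slope s| by exact: sumr_ge0.
have rb0 : 0 <= rew_bound.
  by rewrite !addr_ge0 ?mulr_ge0 // sumr_ge0 // => s _; exact: sumr_ge0.
have fb0 : 0 <= flow_bound by rewrite addr_ge0 // mulr_ge0 // sumr_ge0 // => i _; exact: sumr_ge0.
have one t : lp_obj r y + \sum_s f t 0 s * rew_slope s - rew_bound * p t <= exp_rew P r q S0 t.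
  pose h sg := rew sg - (lp_obj r y + \sum_s dv y sg.1.1 T 0 s * rew_slope s).
  have : `|\sum_sg dist t sg * h sg| <= rew_bound * p t.
    apply: dist_bad_bound => // [sg rs full|sg rs]; first by rewrite /h rew_full // subrr.
    apply: le_trans (ler_normB _ _) _; rewrite /rew_bound -addrA; apply: lerD; first exact: rew_le.
    apply: le_trans (ler_normD _ _) _; rewrite lerD2l.
    apply: le_trans (ler_norm_sum _ _ _) _; rewrite mulr_sumr ler_sum // => s _.
    by rewrite normrM ler_wpM2r // dv_le2.
  have -> : \sum_sg dist t sg * h sg =
      exp_rew P r q S0 t - (lp_obj r y + \sum_s f t 0 s * rew_slope s).
    rewrite exp_rewE (eq_bigr (fun sg => dist t sg * rew sg - (dist t sg * lp_obj r y
       + dist t sg * \sum_s dv y sg.1.1 T 0 s * rew_slope s))); last first.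
      by move=> sg _; rewrite /h mulrBr mulrDr.
    rewrite sumrB big_split /= -mulr_suml (dist_mass Pok pol) mul1r; congr (_ - (_ + _)).
    under eq_bigr do rewrite mulr_sumr.
    rewrite exchange_big /=; apply: eq_bigr => s _.
    by rewrite mxE mulr_suml; apply: eq_bigr => sg _; rewrite mulrA.
  by rewrite ler_norml => /andP[]; lra.
have : \sum_(t < m) (lp_obj r y + \sum_s f t 0 s * rew_slope s - rew_bound * p t)
   <= \sum_(t < m) exp_rew P r q S0 t by apply: ler_sum => t _; exact: one.
rewrite sumrB big_split /= sumr_const card_ord -mulr_sumr -/Sp -[lp_obj r y *+ m]mulr_natl exchange_big /=.
set X := \sum_s \sum_(t < m) _.
have hX : `|X| <= (\sum_s `|rew_slope s|) * nm (\sum_(t < m) f t).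
  apply: le_trans (ler_norm_sum _ _ _) _; rewrite mulr_suml ler_sum // => s _.
  by rewrite -mulr_suml normrM mulrC ler_wpM2l // -summxE le_nm.
have hn := mean_dv_sum_le m; rewrite -/Sp in hn.
have hn2 : cu * (4 + n%:R * flow_bound * Sp) / (1 - rho) <=
   (cu * (4 + n%:R * flow_bound) / (1 - rho)) * (1 + Sp).
  rewrite [leRHS]mulrAC ler_pM2r ?invr_gt0 // -[leRHS]mulrA ler_pM2l //.
  have nfb : 0 <= n%:R * flow_bound by rewrite mulr_ge0.
  by move: nfb Sp0; nra.
have hX2 : `|X| <= (\sum_s `|rew_slope s|) * ((cu * (4 + n%:R * flow_bound) / (1 - rho)) * (1 + Sp)).
  by apply: le_trans hX _; rewrite ler_wpM2l //; exact: le_trans hn hn2.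
move: hX2; rewrite ler_norml => /andP[hX3 _] h.
have rs : rew_bound * Sp <= rew_bound * (1 + Sp) by rewrite ler_wpM2l // lerDr.
apply: le_trans h; rewrite /gap_const [X in _ - X]mulrDl.
by move: rs hX3; rewrite !mulrA => rs hX3; lra.
Qed.

(** The first T0 times contribute at most T0 to the sum of the [p t], which disappears in the
    average. *)
Lemma avg_gap (T0 : nat) (b : R) :
  (forall t, (T0 <= t)%N -> p t <= b) ->
  lp_obj r y - avg_reward P r q S0 <= gap_const * b.
Proof.
move=> hp; have b0 : 0 <= b by apply: le_trans (bad_mass_ge0 T0) (hp _ (leqnn _)).
have p1 t : p t <= 1.
  rewrite -(dist_mass Pok pol S0 t); apply: ler_sum => sg _.
  by rewrite ler_piMr ?(dist_ge0 Pok pol) // lern1; case: (sl sg < 0)%R.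
have gc0 : 0 <= gap_const.
  have r1 : 0 < 1 - rho by move: rho01; lra.
  have fb0 : 0 <= flow_bound by rewrite addr_ge0 // mulr_ge0 // sumr_ge0 // => i _; exact: sumr_ge0.
  rewrite !addr_ge0 ?mulr_ge0 ?invr_ge0 ?(ltW r1) ?(ltW cu0) ?addr_ge0 ?mulr_ge0 ?sumr_ge0 //.
  by move=> s _; exact: sumr_ge0.
have sp m : \sum_(t < m) p t <= T0%:R + m%:R * b.
  rewrite -[m in m%:R]card_ord -mulr_natl.
  apply: (@le_trans _ _ (\sum_(t < m) ((t < T0)%N%:R + b))).
    apply: ler_sum => t _; case: (ltnP t T0) => h; first by rewrite ler_wpDr.
    by rewrite add0r hp.
  rewrite big_split /= sumr_const !card_ord mulr_natl mulr_natl lerD2r.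
  rewrite -natr_sum ler_nat; elim: (m) => [|k IH]; first by rewrite big_ord0.
  have [kT|kT] := ltnP k T0; last by rewrite big_ord_recr /= ltnNge kT addn0.
  apply: (@leq_trans (\sum_(t < k.+1) 1)); first by apply: leq_sum => t _; case: (_ < _)%N.
  by rewrite sum_nat_const card_ord muln1.
rewrite lerBlDr -lerBlDl.
apply/ler_addgt0Pr => w w0; rewrite -lerBlDr; apply: limr_ge; first exact: (@dist_cesaro _ _ _ _ _ _ Pok _ _ _ _ _ pol).
near=> m.
have m0 : 0 < m%:R :> R by near: m; exact: nbhs_infty_gtr.
rewrite [leRHS]mulrC ler_pdivlMr //; apply: le_trans (sum_rew_ge m).
have hm : gap_const * (1 + T0%:R) / w <= m%:R by near: m; exact: nbhs_infty_ger.
have : gap_const * (1 + \sum_(t < m) p t) <= gap_const * (1 + (T0%:R + m%:R * b)).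
  by rewrite ler_wpM2l // lerD2l sp.
by move: hm; rewrite ler_pdivrMr //; nra.
Unshelve. all: by end_near.
Qed.
End Gap.

(** * Probability that the full set has negative slack *)

Section FeasibleProb.
Context {R : realType} {n : nat}.
Variables (P : 'I_n -> bool -> 'I_n -> R) (alpha : R).
Variables (y : 'I_n -> bool -> R) (st : 'I_n).
Hypotheses (Pok : kernel_ok P) (alpha01 : 0 < alpha < 1) (yfeas : lp_feasible P alpha y)
  (A2 : assumption2 y st).
Local Notation nm := (Unorm P alpha y st).
Variables (rho cu c0 q0 : R).
Hypotheses (nmD : forall v w, nm (v + w) <= nm v + nm w) (rho01 : 0 <= rho < 1)
  (cu0 : 0 < cu) (nmF : forall v, nm (v *m Phi P alpha y st) <= rho * nm v)
  (nm_l1 : forall v, nm v <= cu * l1 v)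
  (mix : forall (v : 'rV[R]_n) k, \sum_s v 0 s = 0 -> l1 (v *m Ppi P y ^+ k) <= c0 * q0 ^+ k * l1 v).
Variables (eta e c kappa : R) (L J : nat).
Hypotheses (eta0 : 0 < eta) (e0 : 0 <= e) (cpos : 0 < c <= 1/4) (kap : 0 <= kappa <= 1/2)
  (Lpos : (0 < L)%N) (Jc : 1 <= J%:R * c) (c0q : 0 <= c0 * q0 ^+ L).
Hypotheses (C1 : cu * e <= (1 - rho) * (eta * c - e))
  (C2 : cu * (2 * (c0 * q0 ^+ L) + 3 * e * L%:R + 6 * c * L%:R) + (2 + 2 * eta) * e
        <= eta * beta alpha * kappa)
  (C3 : cu * e + 2 * cu * kappa <= (1 - rho) * (eta / 2 - e)).
Variables (N : nat) (efe erd eps : R) (q : rule (R:=R) (n:=n) N).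
Hypotheses (N0 : (0 < N)%N) (efe0 : 0 <= efe <= e) (erd0 : 0 <= erd <= e)
  (Ne : N%:R^-1 <= e) (eps01 : 0 < eps <= 1)
  (epse : n%:R * eps + 2 * (2 * n%:R + 1) / N%:R <= e)
  (pol : two_set_policy P alpha y st eta efe erd q).
Variable (S0 : svec (n:=n) N).
Local Notation sl v D := (slack P alpha y st eta efe v D).
Let T := (L * J.+1).+1.
Let NR : 0 < N%:R :> R. Proof. by rewrite ltr0n. Qed.

(** The branch D^OL = [N] also yields a maximal feasible set, as [N] has no proper superset; the
    path analysis can then treat all branches alike. *)
Lemma decision_maxfeas sg (d : dec N) : valid_at P alpha y st eta efe erd sg (q sg) -> 0 < q sg d ->
  maxfeas P alpha y st eta efe erd sg.1.1 d.1.1.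
Proof.
case: sg d => [[sv Ap] Qp] [[A Q] a] [_ _ hv _] /hv [h _ _ _ _] /=.
move: h; case: ifP => [full -> |_]; last by case: ifP => [_ []|].
split; first by left.
move=> D DT _; have -> : D = [set: 'I_N] by apply/eqP; rewrite -finset.subTset.
by rewrite lerDl; case/andP: erd0.
Qed.

Lemma quiet_path_feasible (h : nat -> cstate (n:=n) N) (av : nat -> avec N) :
  (forall j, (j < T)%N -> [/\ reach P q S0 (h j),
     0 < q (h j) ((h j.+1).1.2, (h j.+1).2, av j) &
     quiet P eps (h j) ((h j.+1).1.2, (h j.+1).2, av j) (h j.+1).1.1]) ->
  0 <= sl (h T).1.1 [set: 'I_N].
Proof.
move=> path.
have mf j : (j < T)%N -> maxfeas P alpha y st eta efe erd (h j).1.1 (h j.+1).1.2.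
  by move=> /path [/(reach_valid pol) val qp _]; exact: (decision_maxfeas val qp).
have vd j : (j < T)%N -> valid_dec P alpha y st eta efe erd (h j) ((h j.+1).1.2, (h j.+1).2, av j).
  by move=> /path [/(reach_valid pol) val qp _]; move: val qp; case: (h j) => [[? ?] ?] [_ _ + _]; apply.
(* The decision of time j is stored in the chain state of time j + 1, hence the shifted index. *)
apply: (good_path_feasible (sv := fun j => (h j).1.1) (A := fun j => (h j.+1).1.2)
  (Q := fun j => (h j.+1).2) Pok alpha01 yfeas nmD rho01 cu0 nmF nm_l1 mix eta0 e0 cpos kap Lpos
  Jc c0q C1 C2 C3 N0 efe0 erd0).
- by move=> j /mf [].
- by move=> j /mf [].
- move=> j /vd; case: (h j.+1) => [[sv1 A1] Q1] /= [h1 _ _ _ _] hs.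
  by move: h1; case: ifP => [_ -> |_]; [exact: finset.subsetT | rewrite hs => -[]].
- by move=> j /vd; case: (h j) => [[sv1 A1] Q1] [_ [_ ? _] _ _ _].
- move=> j /vd; case: (h j) => [[sv1 A1] Q1] [_ [_ _ /andP[h1 h2]] _ _ _].
  have e1 : 1 - mD (R:=R) (h j.+1).1.2 = (N - #|(h j.+1).1.2|)%:R / N%:R.
    rewrite natrB; last by rewrite -[leqRHS]card_ord max_card.
    by rewrite mulrBl divff ?gt_eqF.
  rewrite e1 mulrA /mD ler_pM2r ?invr_gt0 // h1 /=.
  rewrite ler_pdivrMr // mulrDl divfK ?gt_eqF //.
  apply: le_trans (ltW h2) _; rewrite lerD2l.
  by have := Ne; rewrite -[X in X <= _]mul1r ler_pdivrMr.
- by move=> j /vd; case: (h j.+1) => [[sv1 A1] Q1] [_ [? _ _] _ _ _].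
- move=> j /path [/(reach_valid pol) val qp /andP[/fintype.forallP qu _]].
  apply: le_trans epse; move: val qp qu; case: (h j) => [[sv1 A1] Q1] val qp qu.
  exact: (olc_step Pok yfeas A2 N0 val qp qu).
- move=> j /path [/(reach_valid pol) val qp /andP[_ /fintype.forallP qu]].
  apply: (@le_trans _ _ (n%:R * eps + 2 * n%:R / N%:R)); last first.
    apply: le_trans epse; rewrite lerD2l ler_pM2r ?invr_gt0 //.
    by have := ler0n R n; lra.
  move: val qp qu; case: (h j) => [[sv1 A1] Q1] val qp qu.
  exact: (uoc_step Pok yfeas N0 val qp qu).
Qed.

(** Looking back T steps from t, whatever the law at t - T: the quiet part of the mass never ends at
    a state of negative slack, so such states are charged only by the lost mass. *)
Lemma infeasible_prob t : (T <= t)%N ->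
  \sum_sg dist P q S0 t sg * (sl sg.1.1 [set: 'I_N] < 0)%R%:R <= T%:R * loud_bound (n:=n) N eps.
Proof.
move=> Tt; set t0 := (t - T)%N; have -> : t = (t0 + T)%N by rewrite subnK.
have hm := qdist_mass Pok pol S0 eps01 t0 T.
have : \sum_sg dist P q S0 (t0 + T) sg * (sl sg.1.1 [set: 'I_N] < 0)%R%:R
  <= \sum_sg (dist P q S0 (t0 + T) sg - qdist P q S0 eps t0 T sg).
  apply: ler_sum => sg _; have /andP[h0 h1] := qdist_bounds Pok pol S0 eps t0 T sg.
  have [hs|hs] := ltP (sl sg.1.1 [set: 'I_N]) 0; last by rewrite mulr0 subr_ge0.
  rewrite mulr1 (_ : qdist _ _ _ _ _ _ _ = 0) ?subr0 //.
  apply/eqP; rewrite eq_le h0 andbT leNgt; apply/negP => /(qdist_path Pok pol)[h [av [hT hp]]].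
  by have := quiet_path_feasible hp; rewrite hT leNgt hs.
rewrite sumrB (dist_mass Pok pol); lra.
Qed.
End FeasibleProb.

(** * Choice of constants and conclusion *)

Lemma geometric_small (R : realType) (c q b : R) : 0 <= c -> 0 < q < 1 -> 0 < b ->
  exists2 L, (0 < L)%N & c * q ^+ L <= b.
Proof.
move=> c0 /andP[q0 q1] b0.
have : ((fun k : nat => (c * q ^+ k)%R) @ \oo --> (0%R : R))%classic.
  by apply: (@cvg_geometric R c q); rewrite ger0_norm // ltW.
move=> /cvgrPdist_le /(_ _ b0) [L _ hL]; exists L.+1 => //.
have := hL L.+1 (leqnSn L); rewrite /= sub0r normrN; apply: le_trans; exact: ler_norm.
Qed.

(** The order of choice is kappa, L, c, e, each depending on the previous ones. In the second
    inequality the terms in q0^L, in c and in e each take at most a quarter of w = eta bet kappa. *)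
Lemma path_constants (R : realType) (rho cu c0 q0 eta bet : R) :
  0 <= rho < 1 -> 0 < cu -> 0 <= c0 -> 0 < q0 < 1 -> 0 < eta -> 0 < bet ->
  exists (e c kappa : R) (L J : nat),
    [/\ 0 < e, 0 < c <= 1/4, 0 <= kappa <= 1/2, (0 < L)%N & 1 <= J%:R * c] /\
    [/\ cu * e <= (1 - rho) * (eta * c - e),
        cu * (2 * (c0 * q0 ^+ L) + 3 * e * L%:R + 6 * c * L%:R) + (2 + 2 * eta) * e
        <= eta * bet * kappa &
        cu * e + 2 * cu * kappa <= (1 - rho) * (eta / 2 - e)].
Proof.
move=> /andP[r0 r1] cu0 c00 q01 eta0 bet0.
have r1' : 0 < 1 - rho by lra.
pose kappa := Num.min (1/2) ((1 - rho) * eta / (16 * cu)).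
have k0 : 0 < kappa.
  by rewrite lt_min; apply/andP; split; [lra | rewrite divr_gt0 ?mulr_gt0].
have k1 : kappa <= 1/2 by rewrite ge_min lexx.
have k2 : 2 * cu * kappa <= (1 - rho) * eta / 8.
  have : kappa <= (1 - rho) * eta / (16 * cu) by rewrite ge_min lexx orbT.
  by rewrite ler_pdivlMr ?mulr_gt0 //; lra.
pose w := eta * bet * kappa.
have w0 : 0 < w by rewrite !mulr_gt0.
have [L L0 hL] := geometric_small c00 q01 (b := w / (8 * cu)) (divr_gt0 w0 (mulr_gt0 (ltr0Sn _ _) cu0)).
have LR : 0 < L%:R :> R by rewrite ltr0n.
pose c := Num.min (1/4) (w / (24 * cu * L%:R)).
have cp : 0 < c.
  by rewrite lt_min; apply/andP; split; [lra | rewrite divr_gt0 ?mulr_gt0].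
have c4 : c <= 1/4 by rewrite ge_min lexx.
have cw : cu * (6 * c * L%:R) <= w / 4.
  have : c <= w / (24 * cu * L%:R) by rewrite ge_min lexx orbT.
  by rewrite ler_pdivlMr ?mulr_gt0 //; lra.
have d1 : 0 < cu + (1 - rho) by lra.
have d2 : 0 < 3 * cu * L%:R + 2 + 2 * eta by rewrite !addr_gt0 ?mulr_gt0.
pose e := Num.min ((1 - rho) * (eta * c) / (cu + (1 - rho))) (w / 4 / (3 * cu * L%:R + 2 + 2 * eta)).
have ep : 0 < e.
  by rewrite lt_min; apply/andP; split; rewrite !divr_gt0 ?mulr_gt0.
have e1 : e * (cu + (1 - rho)) <= (1 - rho) * (eta * c).
  by rewrite -ler_pdivlMr // ge_min lexx.
have e2 : e * (3 * cu * L%:R + 2 + 2 * eta) <= w / 4.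
  by rewrite -ler_pdivlMr // ge_min lexx orbT.
exists e, c, kappa, L, (Num.bound (c^-1)).
split; split=> //.
- by rewrite cp.
- by rewrite (ltW k0).
- rewrite -ler_pdivrMr // div1r ltW // archi_boundP // invr_ge0 ltW //.
- lra.
- have : cu * (c0 * q0 ^+ L) <= w / 8.
    by move: hL; rewrite ler_pdivlMr ?mulr_gt0 //; lra.
  by rewrite -/w; lra.
- have : (1 - rho) * (eta * c) <= (1 - rho) * eta / 4.
    by rewrite -!mulrA ler_pM2l // ler_pM2l // -div1r.
  have := mulr_gt0 r1' eta0; lra.
Qed.

Theorem theorem1 (R : realType) (n : nat)
  (P : 'I_n -> bool -> 'I_n -> R) (r : 'I_n -> bool -> R) (alpha : R)
  (y : 'I_n -> bool -> R) (st : 'I_n)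
  (eta : R) (epsfe epsrd : nat -> R)
  (pol : forall N : nat, @rule R n N) :
  kernel_ok P ->
  0 < alpha < 1 ->
  lp_optimal P r alpha y ->
  assumption1 P y ->
  assumption2 y st ->
  assumption3 P alpha y st ->
  0 < eta ->
  (forall N, 0 <= epsfe N) ->
  (forall N, 0 <= epsrd N) ->
  (exists K1 : R, forall N : nat, (0 < N)%N ->
      epsfe N <= K1 / N%:R /\ epsrd N <= K1 / N%:R) ->
  (forall N : nat, (0 < N)%N -> feas_ensuring P alpha y st N eta (epsfe N)) ->
  (forall N : nat, (0 < N)%N -> (exists k : nat, alpha * N%:R = k%:R) ->
      two_set_policy P alpha y st eta (epsfe N) (epsrd N) (pol N)) ->
  exists C K : R, 0 < C /\ 0 < K /\
    forall N : nat, (0 < N)%N -> (exists k : nat, alpha * N%:R = k%:R) ->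
      forall S0 : @svec n N,
        lp_obj r y - avg_reward P r (pol N) S0
          <= K * expR (- C * N%:R).
Proof.
move=> Pok alpha01 [yfeas _] A1 A2 A3 eta0 fe0 rd0 [K1 hK1] _ hpol.
have [c0 [q0 [c00 q01 mix]]] := Ppi_mixing Pok yfeas A1.
have [nmD [le_nm [rho [cu [rho01 cu0 hnm]]]]] := Unorm_facts A3.
have nmF v := (hnm v).1; have nm_l1 v := (hnm v).2.
have bet0 : 0 < beta alpha.
  by rewrite /beta lt_min; case/andP: alpha01 => -> h; rewrite subr_gt0.
have [e [c [kappa [L [J [[e0 cpos kap Lpos Jc] [C1 C2 C3]]]]]]] :=
  path_constants rho01 cu0 c00 q01 eta0 bet0.
pose T := (L * J.+1).+1.
have n1 : 0 < n%:R :> R by rewrite ltr0n; exact: leq_ltn_trans (ltn_ord st).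
(* The sampling noise n eps takes one half of e and leaves the other half to the roundings. *)
pose eps : R := Num.min 1 (e / (2 * n%:R)).
have eps01 : 0 < eps <= 1.
  by rewrite lt_min ge_min lexx ltr01 /= andbT divr_gt0 ?mulr_gt0.
have epse : n%:R * eps <= e / 2.
  have : eps <= e / (2 * n%:R) by rewrite ge_min lexx orbT.
  by rewrite ler_pdivlMr ?mulr_gt0 //; lra.
(* For N >= z the rounding error is at most e / 2, and 1/N and K1/N are at most e. *)
pose z : R := (1 + `|K1| + 4 * (2 * n%:R + 1)) / e.
pose N1 := Num.bound z.
have z0 : 0 <= z by rewrite divr_ge0 ?(ltW e0) // !addr_ge0 // mulr_ge0 // addr_ge0 // mulr_ge0.
pose C := eps ^+ 2 / 8.
have C0 : 0 < C by rewrite divr_gt0 // exprn_gt0 //; case/andP: eps01.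
(* The second term makes the probability bound trivial for N < N1. *)
pose K2 : R := T%:R * (4 * n%:R) + expR (C * N1%:R).
have K20 : 0 < K2 by rewrite ltr_wpDl ?expR_gt0 // !mulr_ge0.
have prob N : (0 < N)%N -> (exists k : nat, alpha * N%:R = k%:R) -> forall S0 t, (T <= t)%N ->
    \sum_sg dist P (pol N) S0 t sg *
      (slack P alpha y st eta (epsfe N) sg.1.1 [set: 'I_N] < 0)%R%:R
    <= K2 * expR (- C * N%:R).
  move=> N0 aN S0 t Tt; have hp := hpol N N0 aN.
  have NR : 0 < N%:R :> R by rewrite ltr0n.
  have [NN|NN] := leqP N1 N.
    have zN : z <= N%:R.
      by apply: le_trans (ltW (archi_boundP z0)) _; rewrite ler_nat.
    have key x : x <= 1 + `|K1| + 4 * (2 * n%:R + 1) -> x / N%:R <= e.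
      move=> hx; rewrite ler_pdivrMr // mulrC -ler_pdivrMr //; apply: le_trans zN.
      by rewrite ler_pM2r ?invr_gt0.
    have K1e : K1 / N%:R <= e.
      by apply: key; have := ler_norm K1; have := ler0n R n; lra.
    have [f1 f2] := hK1 N N0.
    have Ne : N%:R^-1 <= e.
      by rewrite -div1r; apply: key; have := normr_ge0 K1; have := ler0n R n; lra.
    have en : n%:R * eps + 2 * (2 * n%:R + 1) / N%:R <= e.
      have : (4 * (2 * n%:R + 1)) / N%:R <= e.
        by apply: key; have := normr_ge0 K1; lra.
      by move: epse; lra.
    have fe1 : 0 <= epsfe N <= e by rewrite fe0 (le_trans f1 K1e).
    have rd1 : 0 <= epsrd N <= e by rewrite rd0 (le_trans f2 K1e).
    have cq : 0 <= c0 * q0 ^+ L by rewrite mulr_ge0 // exprn_ge0 //; case/andP: q01 => /ltW.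
    have := infeasible_prob Pok alpha01 yfeas A2 nmD rho01 cu0 nmF nm_l1 mix eta0 (ltW e0)
      cpos kap Lpos Jc cq C1 C2 C3 N0 fe1 rd1 Ne eps01 en hp S0 Tt.
    move=> h; apply: le_trans h _; rewrite /loud_bound -/C mulrA ler_pM2r ?expR_gt0 //.
    by rewrite lerDl expR_ge0.
  apply: (@le_trans _ _ 1).
    rewrite -[leRHS](dist_mass Pok hp S0 t); apply: ler_sum => sg _.
    by rewrite ler_piMr ?(dist_ge0 Pok hp) // lern1; case: (_ < 0)%R.
  apply: (@le_trans _ _ (expR (C * N1%:R) * expR (- C * N%:R))).
    rewrite -expRD -[leLHS]expR0 ler_expR mulNr subr_ge0 ler_pM2l // ler_nat ltnW //.
  by rewrite ler_pM2r ?expR_gt0 // lerDr !mulr_ge0.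
(* The absolute value permits multiplying by a nonnegative bound without settling the sign of
   [gap_const]; the added 1 makes the final constant positive. *)
pose G := `|gap_const P r alpha y st rho cu|.
exists C, (G * K2 + 1); split=> //; split; first by apply: ltr_wpDl => //; rewrite mulr_ge0 ?normr_ge0 ?(ltW K20).
move=> N N0 aN S0.
have hp := hpol N N0 aN.
apply: le_trans (avg_gap r Pok yfeas A2 nmD rho01 cu0 nmF nm_l1 le_nm N0 hp aN (prob N N0 aN S0)) _.
apply: (@le_trans _ _ (G * (K2 * expR (- C * N%:R)))).
  by apply: ler_wpM2r; rewrite ?ler_norm // mulr_ge0 ?expR_ge0 ?(ltW K20).
by rewrite mulrA ler_pM2r ?expR_gt0 // lerDl.
Qed.
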